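(* Let $\{P_n\}_{n\ge 0}$ be the threefold symmetric polynomial sequence defined by $P_0(x)=1$, $P_1(x)=x$, $P_2(x)=x^2$ and $$P_{n+1}(x)=xP_n(x)-n(n-1)P_{n-2}(x),\qquad n\ge2 .$$ Then $\{P_n\}_{n\ge0}$ is $2$-orthogonal with respect to the pair of linear functionals $(u_0,u_1)$ given, for every polynomial $f$ and $k=0,1$, by $$\langle u_k,f\rangle=\frac13\left(\int_0^{\infty}f(x)\,\mathcal U_k(x)\,dx+\omega^{2k-1}\int_0^{\infty\omega}f(x)\,\mathcal U_k(\omega^2x)\,dx+\omega^{1-2k}\int_0^{\infty\omega^2}f(x)\,\mathcal U_k(\omega x)\,dx\right),$$ where $\omega=e^{2\pi i/3}$, $\mathcal U_0(x)=\mathrm{Ai}(x)$ and $\mathcal U_1(x)=-\mathrm{Ai}'(x)$. Moreover, $\frac{1}{n+1}P_{n+1}'(x)=P_n(x)$ for all $n\ge 0$, i.e. $\{P_n\}_{n\ge0}$ is an Appell sequence.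
   Context: $\mathrm{Ai}$ is the Airy function of the first kind. The integrals $\int_0^{\infty\omega^j}$ are along the rays $\{t\omega^j:t\ge0\}$. A sequence of monic polynomials $\{P_n\}_{n\ge0}$ ($\deg P_n=n$) is $2$-orthogonal with respect to $(u_0,u_1)$ if for all $m,n\ge 0$: $\langle u_0,x^mP_n\rangle=0$ if $n\ge 2m+1$ and $\langle u_0,x^mP_{2m}\rangle\neq 0$; $\langle u_1,x^mP_n\rangle=0$ if $n\ge 2m+2$ and $\langle u_1,x^mP_{2m+1}\rangle\ne 0$. Threefold symmetric means $P_n(\omega x)=\omega^nP_n(x)$ for all $n$. *)

(* Defs.v *)
From HB Require Import structures.
From mathcomp Require Import all_boot all_order all_algebra.
From mathcomp Require Import all_classical all_reals all_analysis.
From mathcomp Require Import complex.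

Set Implicit Arguments.
Unset Strict Implicit.
Unset Printing Implicit Defensive.

Import Order.TTheory GRing.Theory Num.Theory.
Import numFieldNormedType.Exports.

Local Open Scope classical_set_scope.
Local Open Scope ring_scope.
Local Open Scope complex_scope.

Section ComplexAnalysis.
Variable R : realType.

Definition cexp (z : R[i]) : R[i] :=
  (expR (complex.Re z) * cos (complex.Im z)) +i* (expR (complex.Re z) * sin (complex.Im z)).

(* The ray {t w : t >= 0} is parametrized by x = t w, so dx = w dt. *)
Definition ray_integrable (w : R[i]) (g : R[i] -> R[i]) : Prop :=
  lebesgue_measure.-integrable `[0, +oo[
    (fun t : R => (complex.Re (g (t%:C * w) * w))%:E) /\
  lebesgue_measure.-integrable `[0, +oo[
    (fun t : R => (complex.Im (g (t%:C * w) * w))%:E).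

(* Meaningful when [ray_integrable w g] holds. *)
Definition ray_integral (w : R[i]) (g : R[i] -> R[i]) : R[i] :=
  (\int[lebesgue_measure]_(t in `[0, +oo[) complex.Re (g (t%:C * w) * w)) +i*
  (\int[lebesgue_measure]_(t in `[0, +oo[) complex.Im (g (t%:C * w) * w)).

(* Contour integral
     Ai z = 1/(2 pi i) int_{oo e^{-i pi/3}}^{oo e^{i pi/3}} exp(t^3/3 - z t) dt
   for all complex z, the contour being the two rays arg t = -pi/3 (incoming)
   and arg t = pi/3 (outgoing), on which the integrand is absolutely
   integrable because t^3 = - |t|^3 (DLMF 9.5.4). *)
Definition Airy (z : R[i]) : R[i] :=
  let g t := cexp (t ^+ 3 / 3%:R - z * t) in
  (2%:R * pi%:C * 'i%C)^-1 *
  (ray_integral (cexp ((pi / 3%:R)%:C * 'i%C)) g -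
   ray_integral (cexp (- (pi / 3%:R)%:C * 'i%C)) g).

(* Complex derivative: R[i]^o is R[i] as a normed space over itself. *)
Definition Airy' : R[i] -> R[i] := derive1 (Airy : R[i]^o -> R[i]^o).

Definition omega : R[i] := cexp ((2%:R * pi / 3%:R)%:C * 'i%C).

Definition calU (k : 'I_2) (z : R[i]) : R[i] :=
  if k == 0 then Airy z else - Airy' z.

Definition functional_u (k : 'I_2) (f : {poly R[i]}) : R[i] :=
  3%:R^-1 *
  (ray_integral 1 (fun x => f.[x] * calU k x) +
   omega ^ (2 * k%:Z - 1) *
     ray_integral omega (fun x => f.[x] * calU k (omega ^+ 2 * x)) +
   omega ^ (1 - 2 * k%:Z) *
     ray_integral (omega ^+ 2) (fun x => f.[x] * calU k (omega * x))).

Definition functional_u_converges (k : 'I_2) (f : {poly R[i]}) : Prop :=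
  [/\ ray_integrable 1 (fun x => f.[x] * calU k x),
      ray_integrable omega (fun x => f.[x] * calU k (omega ^+ 2 * x)) &
      ray_integrable (omega ^+ 2) (fun x => f.[x] * calU k (omega * x))].

End ComplexAnalysis.

Section PolynomialSequences.
Variable R : realType.
Implicit Types (P : nat -> {poly R[i]}) (u : {poly R[i]} -> R[i]).

Definition monic_sequence P : Prop :=
  forall n, P n \is monic /\ size (P n) = n.+1.

Definition threefold_symmetric P : Prop :=
  forall n (x : R[i]), (P n).[omega R * x] = omega R ^+ n * (P n).[x].

Definition two_orthogonal u0 u1 P : Prop :=
  [/\ scalar u0, scalar u1, monic_sequence P,
    forall m n : nat, ((2 * m + 1 <= n)%N -> u0 ('X^m * P n) = 0) /\
      u0 ('X^m * P (2 * m)%N) != 0 &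
    forall m n : nat, ((2 * m + 2 <= n)%N -> u1 ('X^m * P n) = 0) /\
      u1 ('X^m * P (2 * m + 1)%N) != 0].

End PolynomialSequences.

(* Main.v *)
Require Import Defs.
From HB Require Import structures.
From mathcomp Require Import all_boot all_order all_algebra.
From mathcomp Require Import all_classical all_reals all_analysis.
From mathcomp Require Import measurable_realfun complex.
From mathcomp Require Import ring lra zify.

Set Implicit Arguments.
Unset Strict Implicit.
Unset Printing Implicit Defensive.

Import Order.TTheory GRing.Theory Num.Theory.
Import numFieldNormedType.Exports.

(* On the positive half-line both rays of the contour are conjugate, so Ai(x) is
   (1/pi) int_0^oo Im(e^(t^3/3 - x t) dt) along arg t = pi/3.  Inserting t^k gives
   functions B_k with B_0 = Ai, B_1 = - Ai', B_k' = - B_(k+1) and, integrating by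
   parts along the ray, x B_k = k B_(k-1) + B_(k+2).  Each B_k is bounded on x >= 0,
   so this relation alone makes every x^n B_k bounded: no asymptotics are needed.
   Another integration by parts turns it into relations between the moments.  The
   three rays of the functionals only keep the moments of index k mod 3, so that
   u_0(x f) = u_0(f'') and u_1(f) = u_0(f').  Since P_n is an Appell sequence,
   P_(n+1) = x P_n - P_n'', whence u_0(P_n) = 0 for n > 0, and the recurrence
   propagates this to x^m P_n.  Nonvanishing reduces to int_0^oo Ai > 0, i.e. to Ai
   having no zero on x >= 0, which follows from y'' = x y and y -> 0. *)

Local Open Scope classical_set_scope.
Local Open Scope ring_scope.

(** * Functions of rapid decay *)

Section RapidDecay.
Variable R : realType.
Local Notation mu := (@lebesgue_measure R).
Implicit Types f F : R -> R.

(** The weight is chosen because [(1 + x ^+ 2)^-1] has a known finite integral on the half-line: one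
    bound gives both integrability and decay at infinity. *)
Definition rapid f := exists C : R, forall x, 0 <= x -> `|f x| * (1 + x ^+ 2) <= C.

Lemma integrable_oneDsqrV :
  mu.-integrable `[0, +oo[ (fun x : R => ((1 + x ^+ 2)^-1)%:E).
Proof.
apply/integrableP; split.
  apply/measurable_EFinP; apply: measurable_funTS.
  apply: continuous_measurable_fun => x; exact: continuous_oneDsqrV.
rewrite [ltLHS](_ : _ = (pi / 2)%:E) ?ltry// -integral0y_oneDsqr.
apply: eq_integral => x _ /=; congr EFin.
by rewrite ger0_norm// invr_ge0 addr_ge0 ?sqr_ge0.
Qed.

Lemma rapid_integrable f : continuous f -> rapid f ->
  mu.-integrable `[0, +oo[ (EFin \o f).
Proof.
move=> cf [C hC].
apply: (@le_integrable _ _ _ mu _ _ _ (fun x => C%:E * ((1 + x ^+ 2)^-1)%:E)%E).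
- exact: measurable_itv.
- by apply/measurable_EFinP; apply: measurable_funTS; exact: continuous_measurable_fun.
- move=> x /=; rewrite in_itv/= andbT => x0.
  have p : 0 < 1 + x ^+ 2 by rewrite ltr_pwDl// sqr_ge0.
  rewrite lee_fin (le_trans _ (ler_norm _))//.
  by rewrite ler_pdivlMr// hC.
- apply: integrableZl; [exact: measurable_itv|exact: integrable_oneDsqrV].
Qed.

Lemma rapid_cvgn f : rapid f -> f n%:R @[n --> \oo] --> 0.
Proof.
move=> [C hC].
have C0 : 0 <= C by apply: le_trans (hC 0 (lexx _)); rewrite expr0n addr0 mulr1.
apply: norm_cvg0; apply: (@squeeze_cvgr _ _ _ _ (cst 0) (fun n => C * harmonic n)).
- near=> n; rewrite normr_ge0/=.
  have n0 : 0 <= n%:R :> R by [].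
  have n1 : 1 <= n%:R :> R by rewrite ler1n; near: n; exact: nbhs_infty_gt.
  rewrite /harmonic ler_pdivlMr ?ltr0n//; apply: le_trans (hC _ n0).
  by rewrite ler_wpM2l// -natr1; nra.
- exact: cvg_cst.
- rewrite -[X in _ --> X](mulr0 C); apply: cvgM; [exact: cvg_cst|exact: cvg_harmonic].
Unshelve. all: by end_near. Qed.

(** The fundamental theorem on [[0, n]], then [n] tends to infinity; the truncations of [f] are
    dominated by its absolute value, integrable by rapid decay. *)
Lemma Rintegral_FTC2y f F : (forall x : R, is_derive x (1 : R) F (f x)) -> continuous f ->
  rapid f -> F n%:R @[n --> \oo] --> 0 -> \int[mu]_(x in `[0, +oo[) f x = - F 0.
Proof.
move=> dF cf rf F0.
have intf := rapid_integrable cf rf.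
have cF : continuous F.
  by move=> x; apply/differentiable_continuous/derivable1_diffP; case: (dF x).
pose g n : R -> R := f \_ `[0, n%:R].
(* The upper end is [n.+1] so that the interval has positive length; the limit is shifted
   accordingly below. *)
have e n : \int[mu]_(x in `[0, n.+1%:R]) f x = F n.+1%:R - F 0.
  rewrite /Rintegral (@continuous_FTC2 _ _ F) ?ltr0n//.
  - by apply: continuous_in_subspaceT => x _; exact: cf.
  - split.
    + by move=> x _; case: (dF x).
    + by apply: cvg_at_right_filter; exact: cF.
    + by apply: cvg_at_left_filter; exact: cF.
  - by move=> x _; rewrite derive1E; case: (dF x).
have [] := @dominated_convergence _ _ _ mu `[0%R, +oo[%classic (measurable_itv _)
  (fun n => EFin \o g n) (EFin \o f) (fun x => `|f x|%:E).
- move=> n; apply/measurable_EFinP; apply: measurable_funTS.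
  apply/(measurable_restrictT f) => //; apply: measurable_funTS.
  exact: continuous_measurable_fun.
- apply/measurable_EFinP; apply: measurable_funTS.
  exact: continuous_measurable_fun.
- apply: aeW => x /=; rewrite in_itv/= andbT => x0.
  apply: cvg_near_cst; near=> n; rewrite /g patchE ifT// inE/= in_itv/= x0/=.
  by near: n; exact: nbhs_infty_ger.
- exact: integrable_norm.
- apply: aeW => x n /=; rewrite in_itv/= andbT => x0.
  rewrite /g patchE lee_fin; case: ifP => _ //.
  by rewrite normr0.
move=> _ _ h.
have {}h : \int[mu]_(x in `[0, +oo[) g n x @[n --> \oo] -->
   \int[mu]_(x in `[0, +oo[) f x.
  apply: fine_cvg; rewrite fineK; last exact: integrable_fin_num.
  exact: h.
have h2 : \int[mu]_(x in `[0, +oo[) g n x @[n --> \oo] --> 0 - F 0.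
  rewrite -cvg_shiftS/=.
  rewrite (_ : (fun n => _) = (fun n => F n.+1%:R - F 0)).
    apply: cvgB; last exact: cvg_cst.
    by move: F0; rewrite -cvg_shiftS.
  apply/funext => n; rewrite -e -Rintegral_mkcondr; congr Rintegral.
  apply/seteqP; split => x /=; rewrite !in_itv/=; first by case.
  by move=> /andP[-> ->].
by have := cvg_unique _ h h2; rewrite sub0r; apply.
Unshelve. all: by end_near. Qed.

End RapidDecay.

(** * The oscillating kernel on the rays *)

Section AiryKernel.
Variable R : realType.
Local Notation mu := (@lebesgue_measure R).
Implicit Types (s al be ph : R).

(** On the ray [t = s e^(i pi/3)] one has [t^3 = - s^3]. With [al = x cos(pi/3)] and
    [be = x sin(pi/3)] this is the imaginary part of [t^k e^(t^3/3 - x t)] when [ph = k pi/3], and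
    of the same times [dt/ds] when [ph = (k+1) pi/3]. *)
Definition airyK (k : nat) al be ph s : R :=
  s ^+ k * expR (- (s ^+ 3 / 3%:R) - al * s) * sin (ph - be * s).

Lemma is_derive_expR_comp (f : R -> R) (x df : R) : is_derive x (1 : R) f df ->
  is_derive x (1 : R) (fun x => expR (f x)) (df * expR (f x)).
Proof.
by move=> h; have := @is_derive1_comp _ expR f x _ _ (is_derive_expR _) h; rewrite mulrC.
Qed.

Lemma is_derive_sin_comp (f : R -> R) (x df : R) : is_derive x (1 : R) f df ->
  is_derive x (1 : R) (fun x => sin (f x)) (df * cos (f x)).
Proof.
by move=> h; have := @is_derive1_comp _ sin f x _ _ (is_derive_sin _) h; rewrite mulrC.
Qed.

Lemma is_derive_airyK k al be ph s :
  is_derive s (1 : R) (airyK k al be ph)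
    (k%:R * airyK k.-1 al be ph s - airyK k.+2 al be ph s
     - al * airyK k al be ph s
     - be * (s ^+ k * expR (- (s ^+ 3 / 3%:R) - al * s) * cos (ph - be * s))).
Proof.
have d3 : is_derive s (1 : R) (fun s : R => - (s ^+ 3 / 3%:R) - al * s) (- s ^+ 2 - al).
  apply: is_derive_eq.
  rewrite /GRing.scale/=. lra.
have d1 : is_derive s (1 : R) (fun s : R => ph - be * s) (- be).
  apply: is_derive_eq.
  rewrite /GRing.scale/=. lra.
have d2 := is_derive_sin_comp d1.
have d4 := is_derive_expR_comp d3.
have dk : is_derive s (1 : R) (fun s : R => s ^+ k) (k%:R * s ^+ k.-1).
  by apply: DeriveDef; [exact: exprn_derivable|rewrite exp_derive /GRing.scale/= mulr1].
apply: (@is_derive_eq _ _ _ _ _ _ _ _ (is_deriveM (is_deriveM dk d4) d2)).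
rewrite /airyK /GRing.scale/=.
case: k dk => [|k] dk /=; rewrite fctE ?mul0r !exprS; ring.
Qed.

Lemma continuous_airyK k al be ph : continuous (airyK k al be ph).
Proof.
move=> s; apply/differentiable_continuous/derivable1_diffP.
by case: (is_derive_airyK k al be ph s).
Qed.

Lemma expr_le_expR (n : nat) s : 0 <= s -> s ^+ n <= n`!%:R * expR s.
Proof.
move=> s0; case: n => [|n]; first by rewrite expr0 fact0 mul1r -expR0 ler_expR.
rewrite mulrC -ler_pdivrMr ?ltr0n ?fact_gt0//.
by apply: le_trans (expR_ge1Dxn n s0); rewrite lerDr.
Qed.

(** Either [s ^+ 2] is at least [3 a] and the cubic term absorbs the linear one, or [s] itself is at
    most [1 + 3 a]. *)
Lemma cubic_lower_bound (a s : R) : 0 <= a -> 0 <= s ->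
  a * s - s ^+ 3 / 3%:R <= a * (1 + 3%:R * a).
Proof.
move=> a0 s0; have [h|h] := lerP (3%:R * a) (s ^+ 2).
  have : s * (3%:R * a) <= s * s ^+ 2 by rewrite ler_wpM2l.
  rewrite -exprS; nra.
have h1 : s <= 1 + 3%:R * a by nra.
have h2 : 0 <= s ^+ 3 by rewrite exprn_ge0.
have : a * s <= a * (1 + 3%:R * a) by rewrite ler_wpM2l.
lra.
Qed.

Lemma rapid_kernel (k : nat) al :
  rapid (fun s => s ^+ k * expR (- (s ^+ 3 / 3%:R) - al * s)).
Proof.
(* The extra 1 leaves a factor [expR (- s)], which absorbs both [s ^+ k] and [s ^+ k.+2]. *)
pose a := `|al| + 1.
have a0 : 0 <= a by rewrite addr_ge0.
exists (expR (a * (1 + 3%:R * a)) * (k`!%:R + k.+2`!%:R)) => s s0.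
rewrite ger0_norm ?mulr_ge0 ?exprn_ge0 ?expR_ge0//.
have h : expR (- (s ^+ 3 / 3%:R) - al * s) <= expR (a * (1 + 3%:R * a)) * expR (- s).
  rewrite -expRD ler_expR.
  have := cubic_lower_bound a0 s0.
  have : - al * s <= `|al| * s by rewrite ler_wpM2r// -normrN ler_norm.
  have : a * s = `|al| * s + s by rewrite /a mulrDl mul1r.
  lra.
rewrite mulrAC; apply: le_trans (ler_wpM2l _ h) _.
  by rewrite mulr_ge0 ?exprn_ge0// addr_ge0 ?sqr_ge0.
rewrite mulrCA ler_wpM2l ?expR_ge0//.
rewrite expRN ler_pdivrMr ?expR_gt0// mulrDr mulr1 -exprD addn2 mulrDl.
by apply: lerD; exact: expr_le_expR.
Qed.

Lemma rapid_airyK k al be ph : rapid (airyK k al be ph).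
Proof.
have [C hC] := rapid_kernel k al; exists C => s s0.
apply: le_trans (hC _ s0); rewrite ler_wpM2r ?addr_ge0 ?sqr_ge0//.
by rewrite normrM ler_piMr// sin_max.
Qed.

Lemma integrable_airyK k al be ph :
  mu.-integrable `[0, +oo[ (EFin \o airyK k al be ph).
Proof. by apply: rapid_integrable; [exact: continuous_airyK|exact: rapid_airyK]. Qed.

End AiryKernel.

(** * The Airy function on the real line and its moments *)

Section AiryReal.
Variable R : realType.
Local Notation mu := (@lebesgue_measure R).
Local Notation th := (pi / 3%:R : R).
Implicit Types (x s : R).

Lemma measurable_half_line : measurable (`[0, +oo[%classic : set (measurableTypeR R)).
Proof. exact: measurable_itv. Qed.

Lemma cos_th_gt0 : 0 < cos th :> R.
Proof. by have p := pi_gt0 R; apply: cos_gt0_pihalf; apply/andP; split; lra. Qed.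

Lemma sin_th_gt0 : 0 < sin th :> R.
Proof. by have p := pi_gt0 R; apply: sin_gt0_pi; apply/andP; split; lra. Qed.

Definition airyI (k : nat) x : R :=
  \int[mu]_(s in `[0, +oo[) airyK k (cos th * x) (sin th * x) (k.+1%:R * th) s.

(* [airyB k] is [(-1)^k] times the [k]-th derivative of [Ai] on the reals. *)
Definition airyB (k : nat) x : R := pi^-1 * airyI k x.

(** This is the imaginary part of [d/ds (t^k e^(t^3/3 - x t)) = (k t^(k-1) + t^(k+2) - x t^k)
    e^(t^3/3 - x t) dt/ds]; the factor [dt/ds] adds [th] to each phase on the right. *)
Lemma is_derive_airyK_boundary k x s :
  is_derive s (1 : R) (airyK k (cos th * x) (sin th * x) (k%:R * th))
    (k%:R * airyK k.-1 (cos th * x) (sin th * x) (k.-1.+1%:R * th) s +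
     airyK k.+2 (cos th * x) (sin th * x) (k.+3%:R * th) s -
     x * airyK k (cos th * x) (sin th * x) (k.+1%:R * th) s).
Proof.
apply: (is_derive_eq (is_derive_airyK _ _ _ _ _)).
have -> : k%:R * airyK k.-1 (cos th * x) (sin th * x) (k.-1.+1%:R * th) s =
  k%:R * airyK k.-1 (cos th * x) (sin th * x) (k%:R * th) s.
  by case: k => [|k]; rewrite ?mul0r.
(* The phases differ by [3 th = pi], which reverses the sign of the sine. *)
have -> : airyK k.+2 (cos th * x) (sin th * x) (k.+3%:R * th) s =
  - airyK k.+2 (cos th * x) (sin th * x) (k%:R * th) s.
  rewrite /airyK -[RHS]mulrN -sinDpi; congr (_ * sin _).
  by rewrite -[in LHS]addn3 natrD; field.
have -> : airyK k (cos th * x) (sin th * x) (k.+1%:R * th) s =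
  cos th * airyK k (cos th * x) (sin th * x) (k%:R * th) s +
  sin th * (s ^+ k * expR (- (s ^+ 3 / 3%:R) - (cos th * x) * s) *
    cos (k%:R * th - (sin th * x) * s)).
  rewrite /airyK (_ : k.+1%:R * th - sin th * x * s = (k%:R * th - sin th * x * s) + th).
    by rewrite (sinD _ th); ring.
  by rewrite -[in LHS]addn1 natrD; field.
ring.
Qed.

(** For [k > 0] the power vanishes at 0; for [k = 0] the phase does. *)
Lemma airyK_at0 k (al be : R) : airyK k al be (k%:R * th) 0 = 0.
Proof.
rewrite /airyK mulr0 subr0; case: k => [|k]; last by rewrite expr0n/= !mul0r.
by rewrite mul0r mulr0 subr0 sin0 mulr0.
Qed.

(** Integrate [is_derive_airyK_boundary] along the ray: the boundary terms vanish at both ends. *)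
Lemma airyI_rec k x : x * airyI k x = k%:R * airyI k.-1 x + airyI k.+2 x.
Proof.
pose K j p := airyK j (cos th * x) (sin th * x) (p%:R * th).
pose f s := k%:R * K k.-1 k.-1.+1 s + K k.+2 k.+3 s - x * K k k.+1 s.
have iK j p : mu.-integrable `[0, +oo[ (EFin \o K j p) by exact: integrable_airyK.
have iZ r j p : mu.-integrable `[0, +oo[ (EFin \o (fun s => r * K j p s)).
  exact: (integrableZl measurable_half_line r (iK j p)).
have rK j p : rapid (K j p) by exact: rapid_airyK.
have cK j p : continuous (K j p) by exact: continuous_airyK.
have : \int[mu]_(s in `[0, +oo[) f s = - K k k 0.
  apply: Rintegral_FTC2y.
  - by move=> s; exact: is_derive_airyK_boundary.
  - move=> s; apply: cvgB; first apply: cvgD.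
    + by apply: cvgMr; exact: cK.
    + exact: cK.
    + by apply: cvgMr; exact: cK.
  - have [C1 h1] := rK k.-1 k.-1.+1; have [C2 h2] := rK k.+2 k.+3.
    have [C3 h3] := rK k k.+1.
    exists (k%:R * C1 + C2 + `|x| * C3) => s s0.
    have p : 0 <= 1 + s ^+ 2 by rewrite addr_ge0 ?sqr_ge0.
    have /(ler_wpM2r p) h : `|f s| <=
        k%:R * `|K k.-1 k.-1.+1 s| + `|K k.+2 k.+3 s| + `|x| * `|K k k.+1 s|.
      rewrite (le_trans (ler_normB _ _))// normrM lerD2r.
      by rewrite (le_trans (ler_normD _ _))// normrM normr_nat.
    apply: (le_trans h); rewrite !mulrDl -!mulrA; apply: lerD; first apply: lerD.
    + by rewrite ler_wpM2l// h1.
    + exact: h2.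
    + by rewrite ler_wpM2l// h3.
  - exact/rapid_cvgn/rK.
rewrite /f RintegralB ?RintegralD ?RintegralZl//.
- rewrite -/(airyI k x) -/(airyI k.+2 x) -/(airyI k.-1 x).
  have -> : K k k 0 = 0.
    exact: airyK_at0.
  by rewrite oppr0 => /eqP; rewrite subr_eq0 => /eqP ->.
all: try exact: iK.
all: try exact: iZ.
all: try exact: measurable_half_line.
exact: (integrableD measurable_half_line (iZ k%:R k.-1 k.-1.+1) (iK k.+2 k.+3)).
Qed.

(** Differentiating [e^(- x t)] in [x] brings down [- t = - s e^(i th)]: one more power of [s] and a
    phase shift by [th]. *)
Lemma is_derive_airyK_param k (ph : R) s x :
  is_derive x (1 : R) (fun x => airyK k (cos th * x) (sin th * x) ph s)
    (- airyK k.+1 (cos th * x) (sin th * x) (ph + th) s).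
Proof.
rewrite /airyK.
have d1 : is_derive x (1 : R) (fun x : R => ph - sin th * x * s) (- (sin th * s)).
  by apply: is_derive_eq; rewrite /GRing.scale/=; lra.
have d3 : is_derive x (1 : R) (fun x : R => - (s ^+ 3 / 3%:R) - cos th * x * s)
    (- (cos th * s)).
  by apply: is_derive_eq; rewrite /GRing.scale/=; lra.
have d2 := is_derive_sin_comp d1.
have d4 := is_derive_expR_comp d3.
apply: (@is_derive_eq _ _ _ _ _ _ _ _ (is_deriveM (is_deriveZ (s ^+ k) d4) d2)).
rewrite /GRing.scale/= (_ : ph + th - sin th * x * s = (ph - sin th * x * s) + th).
  by rewrite (sinD _ th) [s ^+ k.+1]exprS -[_ *: _]/(_ * _); ring.
by ring.
Qed.

Lemma is_derive_airyI k x : is_derive x (1 : R) (airyI k) (- airyI k.+1 x).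
Proof.
pose f (x s : R) := airyK k (cos th * x) (sin th * x) (k.+1%:R * th) s.
have df y s : partial1of2 f y s =
   - airyK k.+1 (cos th * y) (sin th * y) (k.+2%:R * th) s.
  rewrite partial1of2E (@derive_val _ _ _ _ _ _ _ (is_derive_airyK_param _ _ _ _)).
  by congr (- airyK _ _ _ _ _); rewrite -[in RHS]addn1 natrD; ring.
(* For [y] within 1 of [x] the absolute value of [cos th * y] is at most [|x| + 1], so this
   majorant, free of [y], dominates all the partial derivatives. *)
pose G (s : R) := `|s ^+ k.+1 * expR (- (s ^+ 3 / 3%:R) - (- (`|x| + 1)) * s)|.
have Ix : (`]x - 1, x + 1[%classic : set R) x by rewrite /= in_itv/=; lra.
have G0 s : 0 <= G s by exact: normr_ge0.
have iG : mu.-integrable `[0, +oo[ (EFin \o G).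
  apply: rapid_integrable.
    move=> s; apply: cvg_norm.
    (* With [be = 0] and phase [pi / 2] the sine is constantly 1, so the bare kernel is itself an
       [airyK]. *)
    have := @continuous_airyK R k.+1 (- (`|x| + 1)) 0 (pi / 2) s.
    have -> // : airyK k.+1 (- (`|x| + 1)) 0 (pi / 2) =
      (fun s => s ^+ k.+1 * expR (- (s ^+ 3 / 3%:R) - (- (`|x| + 1)) * s)).
    by apply/funext => t; rewrite /airyK mul0r subr0 sin_pihalf mulr1.
  have [C hC] := rapid_kernel k.+1 (- (`|x| + 1)).
  by exists C => s s0; rewrite /G normr_id; exact: hC.
have bG y s : (`]x - 1, x + 1[%classic : set R) y -> `[0, +oo[%classic s ->
    `|partial1of2 f y s| <= G s.
  rewrite /= !in_itv/= andbT => /andP[y1 y2] s0; rewrite df normrN /airyK normrM.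
  rewrite (le_trans (ler_piMr _ (sin_max _)))// /G !normrM ler_wpM2l//.
  rewrite !(ger0_norm (expR_ge0 _)) ler_expR lerD2l lerN2 ler_wpM2r// lerNl.
  have hy : `|y| <= `|x| + 1.
    by rewrite ler_norml; have := ler_norm x; have := ler_norm (- x); rewrite normrN; lra.
  rewrite -mulrN (le_trans (ler_norm _))// normrM normrN (le_trans _ hy)//.
  by rewrite ler_piMl// cos_max.
have intf y : (`]x - 1, x + 1[%classic : set R) y ->
    mu.-integrable `[0, +oo[ (EFin \o f y).
  by move=> _; exact: integrable_airyK.
have derf y s : (`]x - 1, x + 1[%classic : set R) y -> `[0, +oo[%classic s ->
    derivable (f ^~ s) y 1.
  by move=> _ _; case: (is_derive_airyK_param k (k.+1%:R * th) s y).
apply: DeriveDef.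
  exact: (derivable_under_integral measurable_half_line Ix intf derf G0 iG bG).
rewrite -derive1E.
rewrite (differentiation_under_integral measurable_half_line Ix intf derf G0 iG bG).
under eq_Rintegral do rewrite df -mulN1r.
by rewrite RintegralZl ?mulN1r//; exact: integrable_airyK.
Qed.

Lemma airyB_rec k x : x * airyB k x = k%:R * airyB k.-1 x + airyB k.+2 x.
Proof. by rewrite /airyB mulrCA airyI_rec; ring. Qed.

Lemma is_derive_airyB k x : is_derive x (1 : R) (airyB k) (- airyB k.+1 x).
Proof.
have h := is_derive_airyI k x.
by apply: (is_derive_eq (is_deriveZ pi^-1 h)); rewrite /airyB /GRing.scale/= mulrN.
Qed.

Lemma continuous_airyB k : continuous (airyB k).
Proof.
move=> s; apply/differentiable_continuous/derivable1_diffP.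
by case: (is_derive_airyB k s).
Qed.

(** For [x >= 0] the factor [expR (- (cos th * x) * s)] is at most 1, as [cos th > 0]; dropping it
    leaves a bound independent of [x]. *)
Lemma airyB_bounded k : exists C : R, forall x, 0 <= x -> `|airyB k x| <= C.
Proof.
pose M s := s ^+ k * expR (- (s ^+ 3 / 3%:R) - 0 * s) : R.
have iM : mu.-integrable `[0, +oo[ (EFin \o M).
  have := @integrable_airyK R k 0 0 (pi / 2).
  have -> // : airyK k 0 0 (pi / 2) = M.
  by apply/funext => t; rewrite /airyK /M !mul0r !subr0 sin_pihalf mulr1.
exists (pi^-1 * \int[mu]_(s in `[0, +oo[) M s) => x x0.
rewrite normrM ger0_norm ?invr_ge0 ?pi_ge0// ler_wpM2l ?invr_ge0 ?pi_ge0//.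
have iK : mu.-integrable `[0, +oo[
   (EFin \o airyK k (cos th * x) (sin th * x) (k.+1%:R * th)).
  exact: integrable_airyK.
apply: le_trans (le_normr_Rintegral measurable_half_line iK) _.
apply: le_Rintegral iM _; [exact: measurable_half_line|exact: integrable_norm|].
move=> s /=; rewrite in_itv/= andbT => s0; rewrite /airyK normrM.
rewrite (le_trans (ler_piMr _ (sin_max _)))// ger0_norm.
  rewrite ler_wpM2l ?exprn_ge0// ler_expR lerD2l lerN2 ler_wpM2r//.
  by rewrite mulr_ge0// ltW// cos_th_gt0.
by rewrite mulr_ge0 ?exprn_ge0 ?expR_ge0.
Qed.

(* The recurrence trades a factor [x] for a shift of [k], at no cost in growth. *)
Lemma airyB_moderate n k : exists C : R, forall x, 0 <= x -> `|x ^+ n * airyB k x| <= C.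
Proof.
elim: n k => [|n ih] k.
  by have [C hC] := airyB_bounded k; exists C => x x0; rewrite expr0 mul1r hC.
have [C1 h1] := ih k.-1; have [C2 h2] := ih k.+2.
exists (k%:R * C1 + C2) => x x0.
rewrite exprSr -mulrA airyB_rec mulrDr (le_trans (ler_normD _ _))// lerD ?h2//.
by rewrite mulrCA normrM normr_nat ler_wpM2l// h1.
Qed.

Lemma rapid_airyB n k : rapid (fun x => x ^+ n * airyB k x).
Proof.
have [C1 h1] := airyB_moderate n k; have [C2 h2] := airyB_moderate n.+2 k.
exists (C1 + C2) => x x0; rewrite mulrDr mulr1 lerD ?h1//.
apply: le_trans (h2 _ x0).
by rewrite -[n.+2]addn2 exprD mulrAC [leRHS]normrM (ger0_norm (sqr_ge0 x)).
Qed.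

Lemma continuous_exprM_airyB n k : continuous (fun x => x ^+ n * airyB k x).
Proof.
by move=> x; apply: cvgM; [exact: exprn_continuous|exact: continuous_airyB].
Qed.

Lemma integrable_airyB n k :
  mu.-integrable `[0, +oo[ (EFin \o (fun x => x ^+ n * airyB k x)).
Proof.
by apply: rapid_integrable; [exact: continuous_exprM_airyB|exact: rapid_airyB].
Qed.

Definition airyM n k : R := \int[mu]_(x in `[0, +oo[) (x ^+ n * airyB k x).

Lemma airyM_S n : airyM n.+1 0 = airyM n 2.
Proof.
rewrite /airyM; apply: eq_Rintegral => x _.
by rewrite exprSr -mulrA airyB_rec mul0r add0r.
Qed.

(** Integration by parts: [x ^+ n.+1 * airyB k x] vanishes at 0 through the power and at infinity by
    rapid decay. *)
Lemma airyM_parts n k : airyM n.+1 k.+1 = n.+1%:R * airyM n k.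
Proof.
pose f x : R := n.+1%:R * (x ^+ n * airyB k x) - x ^+ n.+1 * airyB k.+1 x.
have iZ : mu.-integrable `[0, +oo[ (EFin \o (fun x => n.+1%:R * (x ^+ n * airyB k x))).
  exact: (integrableZl measurable_half_line n.+1%:R (integrable_airyB n k)).
have : \int[mu]_(x in `[0, +oo[) f x = - ((0 : R) ^+ n.+1 * airyB k 0).
  apply: (Rintegral_FTC2y (F := fun x : R => x ^+ n.+1 * airyB k x)).
  - move=> x.
    have dk : is_derive x (1 : R) (fun s : R => s ^+ n.+1) (n.+1%:R * x ^+ n).
      by apply: DeriveDef; [exact: exprn_derivable|rewrite exp_derive /GRing.scale/= mulr1].
    apply: (@is_derive_eq _ _ _ _ _ _ _ _ (is_deriveM dk (is_derive_airyB k x))).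
    by rewrite /f /GRing.scale/=; ring.
  - move=> x; apply: cvgB; last exact: continuous_exprM_airyB.
    by apply: cvgMr; exact: continuous_exprM_airyB.
  - have [C1 h1] := rapid_airyB n k; have [C2 h2] := rapid_airyB n.+1 k.+1.
    exists (n.+1%:R * C1 + C2) => x x0.
    have p : 0 <= 1 + x ^+ 2 by rewrite addr_ge0 ?sqr_ge0.
    apply: le_trans (ler_wpM2r p (ler_normB _ _)) _.
    by rewrite mulrDl lerD ?h2// normrM normr_nat -mulrA ler_wpM2l// h1.
  - exact: (rapid_cvgn (rapid_airyB n.+1 k)).
rewrite expr0n/= mul0r oppr0 /f RintegralB//; last exact: integrable_airyB.
rewrite RintegralZl//; last exact: integrable_airyB.
by move=> /eqP; rewrite subr_eq0 => /eqP/esym.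
Qed.

End AiryReal.

(** * Positivity of the Airy function on the half-line *)

Section AiryPositivity.
Variable R : realType.
Local Notation mu := (@lebesgue_measure R).
Local Notation th := (pi / 3%:R : R).
Implicit Types (x b c : R) (f : R -> R).

Lemma Rintegral_gt0 f : continuous f -> mu.-integrable `[0, +oo[ (EFin \o f) ->
  (forall x, 0 <= x -> 0 < f x) -> 0 < \int[mu]_(x in `[0, +oo[) f x.
Proof.
move=> cf intf f0.
(* The positive minimum on [[0, 1]] bounds the integral over [[0, 1]] from below; the rest of the
   half-line contributes nonnegatively. *)
have [c c01 hc] : exists2 c, c \in `[(0 : R), 1] & forall t, t \in `[(0 : R), 1] -> f c <= f t.
  by apply: EVT_min => //; exact: continuous_subspaceT.
have c0 : 0 <= c by move: c01; rewrite in_itv/= => /andP[].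
have i01 : mu.-integrable `[0, 1] (EFin \o f).
  apply: integrableS intf => //.
  by move=> x /=; rewrite !in_itv/= => /andP[-> _].
have : f c <= \int[mu]_(x in `[0, 1]) f x.
  have <- : \int[mu]_(x in `[0, 1]) (cst (f c) x) = f c.
    rewrite Rintegral_cst//= lebesgue_measure_itv/= lte_fin ltr01.
    by rewrite -EFinB/= subr0 mulr1.
  apply: le_Rintegral => //.
  apply: continuous_compact_integrable; first exact: segment_compact.
  by apply: continuous_subspaceT => x; exact: cvg_cst.
move=> /(lt_le_trans (f0 _ c0)) /lt_le_trans; apply.
rewrite /Rintegral fine_le//.
  by apply: integrable_fin_num i01.
  by apply: integrable_fin_num intf.
apply: ge0_subset_integral => //.
- by case/integrableP : intf.
- by move=> x /=; rewrite in_itv/= andbT => x0; rewrite lee_fin ltW// f0.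
- by move=> x /=; rewrite !in_itv/= => /andP[-> _].
Qed.

Lemma is_derive_MVT f df a b : (forall x, is_derive x (1 : R) f (df x)) -> a <= b ->
  exists2 c, a <= c <= b & f b - f a = df c * (b - a).
Proof.
move=> hf ab.
have cf : continuous f.
  by move=> x; apply/differentiable_continuous/derivable1_diffP; case: (hf x).
have [c cab h] := @MVT_segment _ f df a b ab (fun x _ => hf x) (continuous_subspaceT cf).
by exists c.
Qed.

Lemma airyB2 x : airyB 2 x = x * airyB 0 x.
Proof. by rewrite airyB_rec mul0r add0r. Qed.

(** At [x = 0] the phase is constant, so [sin th > 0] factors out of the integral of a positive
    function. *)
Lemma airyB00_gt0 : 0 < airyB 0 (0 : R).
Proof.
rewrite /airyB mulr_gt0 ?invr_gt0 ?pi_gt0// /airyI.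
have -> : airyK 0 (cos th * 0) (sin th * 0) (1%:R * th) =
    fun s => sin th * airyK 0 0 0 (pi / 2) s.
  apply/funext => s; rewrite /airyK !mulr0 !mul0r !subr0 sin_pihalf mul1r.
  by rewrite mul1r mulr1 mulrC.
rewrite RintegralZl//; last exact: integrable_airyK.
rewrite mulr_gt0 ?sin_th_gt0//; apply: Rintegral_gt0.
- exact: continuous_airyK.
- exact: integrable_airyK.
- move=> s s0; rewrite /airyK !mul0r !subr0 sin_pihalf mulr1 mul1r.
  exact: expR_gt0.
Qed.

(** With [y = airyB 0] and [airyB 1 = - y'] the product is [- y y']; the equation [y'' = x y] makes
    its derivative nonpositive for [x >= 0]. *)
Lemma is_derive_airyB01 x : is_derive x (1 : R) (fun x => airyB 0 x * airyB 1 x)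
  (- (airyB 1 x ^+ 2 + x * airyB 0 x ^+ 2)).
Proof.
apply: (@is_derive_eq _ _ _ _ _ _ _ _ (is_deriveM (is_derive_airyB 0 x) (is_derive_airyB 1 x))).
by rewrite /GRing.scale/= airyB2; ring.
Qed.

Lemma airyB01_nonincreasing a b : 0 <= a -> a <= b ->
  airyB 0 b * airyB 1 b <= airyB 0 a * airyB 1 a.
Proof.
move=> a0 ab; have [c /andP[ac cb] h] := is_derive_MVT is_derive_airyB01 ab.
rewrite -subr_le0 h; rewrite mulr_le0_ge0 ?subr_ge0// oppr_le0.
by rewrite addr_ge0 ?sqr_ge0// mulr_ge0 ?sqr_ge0// (le_trans a0).
Qed.

(** A nonincreasing function with limit 0 cannot take a negative value. *)
Lemma airyB01_ge0 b : 0 <= b -> 0 <= airyB 0 b * airyB 1 b.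
Proof.
move=> b0.
have B0 k : @airyB R k n%:R @[n --> \oo] --> 0.
  have := rapid_cvgn (rapid_airyB R 0 k).
  by under eq_fun do rewrite expr0 mul1r.
have h : (airyB 0 n%:R * airyB 1 n%:R : R) @[n --> \oo] --> 0.
  by rewrite -[X in _ --> X](mul0r (0 : R)); apply: cvgM; exact: B0.
rewrite leNgt; apply/negP => neg; near \oo => n.
have : airyB 0 b * airyB 1 b < airyB 0 n%:R * airyB 1 n%:R.
  by near: n; exact: cvgr_gt h _ neg.
rewrite ltNge airyB01_nonincreasing//.
by near: n; exact: nbhs_infty_ger.
Unshelve. all: by end_near. Qed.

(* Gronwall for the energy [y ^ 2 + y' ^ 2] of [y'' = x y]. *)
Lemma airyB_unique c : 0 <= c -> airyB 0 c = 0 -> airyB 1 c = 0 -> airyB 0 (0 : R) = 0.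
Proof.
move=> c0 y0 y1.
pose E x := airyB 0 x ^+ 2 + airyB 1 x ^+ 2 : R.
pose dE x := - (2%:R * (1 + x)) * (airyB 0 x * airyB 1 x).
have hE x : is_derive x (1 : R) E (dE x).
  apply: (@is_derive_eq _ _ _ _ _ _ _ _ (is_deriveD (is_deriveX 2 (is_derive_airyB 0 x))
    (is_deriveX 2 (is_derive_airyB 1 x)))).
  by rewrite /GRing.scale/= airyB2 /dE; ring.
(* The rate [1 + c] bounds [1 + x] on [[0, c]], and [2 u v <= u^2 + v^2], so [E] times this
   exponential has nonnegative derivative there; being 0 at [c], it cannot be positive at 0. *)
have he x : is_derive x (1 : R) (fun x => expR ((1 + c) * x)) ((1 + c) * expR ((1 + c) * x)).
  apply: is_derive_expR_comp; apply: is_derive_eq.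
  by rewrite /GRing.scale/=; lra.
have [x /andP[x0 xc]] := is_derive_MVT (fun x => is_deriveM (hE x) (he x)) c0.
rewrite /GRing.scale/= !fctE /= [E c](_ : _ = 0); last by rewrite /E y0 y1; ring.
rewrite mul0r mulr0 expR0 mulr1 sub0r subr0 => h.
have : 0 <= E x * ((1 + c) * expR ((1 + c) * x)) + expR ((1 + c) * x) * dE x.
  rewrite mulrA [X in _ + X]mulrC -mulrDl mulr_ge0 ?expR_ge0//.
  rewrite /dE /E.
  have : 0 <= (airyB 0 x - airyB 1 x) ^+ 2 by exact: sqr_ge0.
  have := airyB01_ge0 x0.
  set u := airyB 0 x; set v := airyB 1 x => uv0 h2.
  have : (1 + x) * (2%:R * (u * v)) <= (1 + c) * (u ^+ 2 + v ^+ 2).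
    by apply: ler_pM; lra.
  lra.
move=> /mulr_ge0 /(_ c0); rewrite -h oppr_ge0 /E => h3.
have : airyB 0 (0 : R) ^+ 2 = 0.
  by apply/eqP; rewrite eq_le sqr_ge0 andbT; apply: le_trans h3; rewrite lerDl sqr_ge0.
by move=> /eqP; rewrite sqrf_eq0 => /eqP.
Qed.

(* A zero [b] of [y = airyB 0] would kill the nonincreasing, nonnegative function
   [- y y'] on [b, +oo[, and with it [y' ^ 2 + x y ^ 2]. *)
Lemma airyB0_neq0 b : 0 <= b -> airyB 0 b != 0.
Proof.
move=> b0; apply/eqP => yb.
have b1 : b <= b + 1 by rewrite lerDl.
have r0 x : b <= x -> airyB 0 x * airyB 1 x = 0.
  move=> bx; apply/eqP; rewrite eq_le airyB01_ge0 ?(le_trans b0)// andbT.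
  by rewrite (le_trans (airyB01_nonincreasing b0 bx))// yb mul0r.
have [c /andP[bc _]] := is_derive_MVT is_derive_airyB01 b1.
rewrite !r0// subrr addrAC subrr add0r mulr1 => /esym/eqP.
have c0 : 0 <= c by exact: le_trans bc.
rewrite oppr_eq0 (paddr_eq0 (sqr_ge0 _) (mulr_ge0 c0 (sqr_ge0 _))) => /andP[].
have sq0 (u : R) : u ^+ 2 == 0 -> u = 0 by rewrite sqrf_eq0 => /eqP.
have mul0 (u v : R) : u * v == 0 -> u = 0 \/ v == 0.
  by rewrite mulf_eq0 => /orP[/eqP|]; [left|right].
(* Here [c y(c)^2 = 0]: if [c = 0] then [b = 0], against [airyB00_gt0]; otherwise [y] and [y'] both
   vanish at [c]. *)
move=> /sq0 y1 /mul0[c00|/sq0 y0].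
  have b00 : b = 0 by apply: le_anti; apply/andP; split; lra.
  by have := airyB00_gt0; rewrite -[X in airyB 0 X]b00 yb ltxx.
by have := airyB00_gt0; rewrite (airyB_unique c0 y0 y1) ltxx.
Qed.

(** Positive at 0 and without zeros, the function keeps its sign by the intermediate value
    theorem. *)
Lemma airyB0_gt0 b : 0 <= b -> 0 < airyB 0 b.
Proof.
move=> b0; rewrite lt_neqAle eq_sym airyB0_neq0//= leNgt; apply/negP => yb.
have cy : {within `[0, b], continuous (@airyB R 0)}.
  by apply: continuous_subspaceT; exact: continuous_airyB.
have [|c /[!in_itv]/= /andP[c0 _] yc] := IVT b0 cy (v := 0).
  by rewrite ge_min le_max (ltW yb) (ltW airyB00_gt0) orbT.
by have := airyB0_neq0 c0; rewrite yc eqxx.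
Qed.

Lemma airyM00_gt0 : 0 < airyM R 0 0.
Proof.
apply: Rintegral_gt0; [exact: continuous_exprM_airyB|exact: integrable_airyB|].
by move=> x x0; rewrite expr0 mul1r airyB0_gt0.
Qed.

End AiryPositivity.

(** * The complex exponential *)

Section CexpTaylor.
Variable R : realType.
Local Open Scope complex_scope.
Implicit Types (x a b r M : R) (f df : R -> R) (z w : R[i]).

(** The mean value inequality on either side of 0. Applied to a remainder, whose derivative is a
    remainder of lower order, it yields the Taylor estimates below. *)
Lemma is_derive_norm_le f df x M : (forall t, is_derive t (1 : R) f (df t)) ->
  (forall t, `|t| <= `|x| -> `|df t| <= M) -> `|f x - f 0| <= M * `|x|.
Proof.
move=> hf hM; have [x0|x0] := lerP 0 x.
  have [c /andP[c0 cx] ->] := is_derive_MVT hf x0.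
  by rewrite subr0 normrM ler_wpM2r// hM// !ger0_norm// (le_trans c0).
have [c /andP[xc c0]] := is_derive_MVT hf (ltW x0).
rewrite distrC sub0r => ->.
rewrite normrM normrN ler_wpM2r// hM// !ler0_norm ?lerN2//; exact: ltW.
Qed.

Lemma norm_expR_sub1 a : `|expR a - 1| <= expR `|a| * `|a|.
Proof.
rewrite -[in X in _ - X](@expR0 R).
apply: (is_derive_norm_le (df := expR)) => t ht.
by rewrite ger0_norm ?expR_ge0// ler_expR (le_trans (ler_norm _)).
Qed.

Lemma norm_expR_sub1D a : `|expR a - 1 - a| <= expR `|a| * `|a| * `|a|.
Proof.
have -> : expR a - 1 - a = (expR a - a) - (expR 0 - 0) by rewrite expR0; ring.
apply: (is_derive_norm_le (f := fun t => expR t - t) (df := fun t => expR t - 1)).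
move=> t ht; apply: le_trans (norm_expR_sub1 t) _.
by rewrite ler_pM// ?expR_ge0// ler_expR.
Qed.

Lemma norm_sin_le b : `|sin b| <= `|b|.
Proof.
have -> : sin b = sin b - sin 0 by rewrite sin0 subr0.
rewrite -[leRHS]mul1r; apply: (is_derive_norm_le (df := cos)) => t _.
exact: cos_max.
Qed.

Lemma norm_cos_sub1 b : `|cos b - 1| <= `|b| * `|b|.
Proof.
rewrite -[in X in _ - X](@cos0 R); apply: (is_derive_norm_le (df := fun t => - sin t)).
by move=> t ht; rewrite normrN (le_trans (norm_sin_le _)).
Qed.

Lemma norm_cos_sub1_linear b : `|cos b - 1| <= `|b|.
Proof.
rewrite -[leRHS]mul1r -[in X in _ - X](@cos0 R).
apply: (is_derive_norm_le (df := fun t => - sin t)).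
by move=> t ht; rewrite normrN sin_max.
Qed.

Lemma norm_sin_subr b : `|sin b - b| <= `|b| * `|b|.
Proof.
have -> : sin b - b = (sin b - b) - (sin 0 - 0) by rewrite sin0; ring.
apply: (is_derive_norm_le (f := fun t => sin t - t) (df := fun t => cos t - 1)).
by move=> t ht; rewrite (le_trans (norm_cos_sub1_linear _)).
Qed.

(** Estimates are kept componentwise because the complex integrals are built from real and imaginary
    parts. Each component splits into two second-order terms, each at most [r ^+ 2 * expR r]. *)
Lemma cexp_taylor w r : `|complex.Re w| <= r -> `|complex.Im w| <= r ->
  `|complex.Re (cexp w - 1 - w)| <= 2%:R * r ^+ 2 * expR r /\
  `|complex.Im (cexp w - 1 - w)| <= 2%:R * r ^+ 2 * expR r.
Proof.
case: w => a b /= ar br.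
have r0 : 0 <= r by exact: le_trans ar.
have er : expR `|a| <= expR r by rewrite ler_expR.
have ea : `|expR a| <= expR r.
  by rewrite ger0_norm ?expR_ge0// ler_expR (le_trans (ler_norm _)).
split.
  have -> : expR a * cos b - 1 - a = (expR a - 1 - a) + expR a * (cos b - 1) by ring.
  apply: le_trans (ler_normD _ _) _; rewrite normrM.
  have h1 := le_trans (norm_expR_sub1D a)
    (ler_pM (mulr_ge0 (expR_ge0 _) (normr_ge0 _)) (normr_ge0 _)
       (ler_pM (expR_ge0 _) (normr_ge0 _) er ar) ar).
  have h2 := ler_pM (normr_ge0 _) (normr_ge0 _) ea
    (le_trans (norm_cos_sub1 b) (ler_pM (normr_ge0 _) (normr_ge0 _) br br)).
  by apply: le_trans (lerD h1 h2) _; rewrite le_eqVlt; apply/orP; left; apply/eqP; ring.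
have -> : expR a * sin b - 0 - b = expR a * (sin b - b) + (expR a - 1) * b by ring.
apply: le_trans (ler_normD _ _) _; rewrite !normrM.
have h1 := ler_pM (normr_ge0 _) (normr_ge0 _) (le_trans (norm_expR_sub1 a)
   (ler_pM (expR_ge0 _) (normr_ge0 _) er ar)) br.
have h2 := ler_pM (normr_ge0 _) (normr_ge0 _) ea
  (le_trans (norm_sin_subr b) (ler_pM (normr_ge0 _) (normr_ge0 _) br br)).
by apply: le_trans (lerD h2 h1) _; rewrite le_eqVlt; apply/orP; left; apply/eqP; ring.
Qed.

Lemma cexpD z w : cexp (z + w) = cexp z * cexp w.
Proof.
case: z w => [a b] [c d]; rewrite /cexp /= expRD cosD sinD.
by apply/eqP; rewrite eq_complex /=; apply/andP; split; apply/eqP; ring.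
Qed.

Lemma cexp_iE a : cexp (a%:C * 'i%C) = cos a +i* sin a.
Proof. by rewrite /cexp /= !mul0r !mulr0 !mulr1 subrr !addr0 ?add0r expR0 !mul1r. Qed.

Lemma cexp_iX a n : cexp (a%:C * 'i%C) ^+ n = cexp ((n%:R * a)%:C * 'i%C).
Proof.
elim: n => [|n ih]; first by rewrite expr0 mul0r cexp_iE cos0 sin0.
by rewrite exprS ih -cexpD -mulrDl -rmorphD/= -[in RHS]nat1r mulrDl mul1r.
Qed.

Lemma norm_Re_mul z w : `|complex.Re (z * w)| <=
  `|complex.Re z| * `|complex.Re w| + `|complex.Im z| * `|complex.Im w|.
Proof. by case: z w => [a b] [c d] /=; rewrite (le_trans (ler_normB _ _))// !normrM. Qed.

Lemma norm_Im_mul z w : `|complex.Im (z * w)| <=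
  `|complex.Re z| * `|complex.Im w| + `|complex.Im z| * `|complex.Re w|.
Proof. by case: z w => [a b] [c d] /=; rewrite (le_trans (ler_normD _ _))// !normrM. Qed.

Lemma normc_le_ReIm z : `|z| <= (`|complex.Re z| + `|complex.Im z|)%:C.
Proof.
case: z => a b; rewrite normc_def lecR /=.
rewrite -[leRHS]ger0_norm ?addr_ge0// -sqrtr_sqr ler_wsqrtr//.
by rewrite sqrrD !real_normK ?num_real// lerD2r lerDl mulrn_wge0.
Qed.

Lemma ReIm_le_normc z : `|complex.Re z|%:C <= `|z| /\ `|complex.Im z|%:C <= `|z|.
Proof.
case: z => a b; rewrite normc_def !lecR /= -!sqrtr_sqr; split; rewrite ler_wsqrtr//.
  by rewrite lerDl sqr_ge0.
by rewrite lerDr sqr_ge0.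
Qed.

End CexpTaylor.

(** * The contour integral *)

Section AiryComplex.
Variable R : realType.
Local Open Scope complex_scope.
Local Notation mu := (@lebesgue_measure R).
Local Notation th := (pi / 3%:R : R).
Implicit Types (x s al be ph : R) (z w h : R[i]) (f g : R -> R[i]).

(** By conversion, [ray_integrable] and [ray_integral] are these notions for the integrand pulled
    back to the ray parameter. *)
Definition cintegrable f :=
  mu.-integrable `[0, +oo[ (fun s => (complex.Re (f s))%:E) /\
  mu.-integrable `[0, +oo[ (fun s => (complex.Im (f s))%:E).

Definition cint f : R[i] :=
  (\int[mu]_(s in `[0, +oo[) complex.Re (f s)) +i*
  (\int[mu]_(s in `[0, +oo[) complex.Im (f s)).

Lemma cintegrableD f g : cintegrable f -> cintegrable g ->
  cintegrable (fun s => f s + g s).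
Proof.
move=> [f1 f2] [g1 g2]; split.
  rewrite (_ : (fun s => _) = (fun s => (complex.Re (f s))%:E + (complex.Re (g s))%:E)%E).
    exact: integrableD.
  by apply/funext => s; case: (f s) (g s) => [a b] [c d].
rewrite (_ : (fun s => _) = (fun s => (complex.Im (f s))%:E + (complex.Im (g s))%:E)%E).
  exact: integrableD.
by apply/funext => s; case: (f s) (g s) => [a b] [c d].
Qed.

Lemma cintD f g : cintegrable f -> cintegrable g ->
  cint (fun s => f s + g s) = cint f + cint g.
Proof.
move=> [f1 f2] [g1 g2]; rewrite /cint; apply/eqP; rewrite eq_complex /= -!RintegralD//.
by apply/andP; split; apply/eqP; congr (fine _); apply: eq_integral => s _;
  case: (f s) (g s) => [a b] [c d].
Qed.

Lemma integrable_linear (a b : R) (u v : R -> R) :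
  mu.-integrable `[0, +oo[ (fun s => (u s)%:E) ->
  mu.-integrable `[0, +oo[ (fun s => (v s)%:E) ->
  mu.-integrable `[0, +oo[ (fun s => (a * u s + b * v s)%:E) /\
  \int[mu]_(s in `[0, +oo[) (a * u s + b * v s) =
  a * \int[mu]_(s in `[0, +oo[) u s + b * \int[mu]_(s in `[0, +oo[) v s.
Proof.
move=> iu iv.
have iau : mu.-integrable `[0, +oo[ (EFin \o (fun s => a * u s)).
  exact: (integrableZl (@measurable_half_line R) a iu).
have ibv : mu.-integrable `[0, +oo[ (EFin \o (fun s => b * v s)).
  exact: (integrableZl (@measurable_half_line R) b iv).
split; first exact: (integrableD (@measurable_half_line R) iau ibv).
by rewrite RintegralD// !RintegralZl.
Qed.

Lemma cintegrableZ z f : cintegrable f -> cintegrable (fun s => z * f s).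
Proof.
case: z => a b [f1 f2]; split.
  have [+ _] := integrable_linear a (- b) f1 f2.
  apply: eq_integrable => // s _; congr EFin.
  by case: (f s) => c d /=; ring.
have [+ _] := integrable_linear a b f2 f1.
apply: eq_integrable => // s _; congr EFin.
by case: (f s) => c d /=; ring.
Qed.

Lemma cintZ z f : cintegrable f -> cint (fun s => z * f s) = z * cint f.
Proof.
case: z => a b [f1 f2]; rewrite /cint.
have [_ e1] := integrable_linear a (- b) f1 f2.
have [_ e2] := integrable_linear a b f2 f1.
apply/eqP; rewrite eq_complex /=; apply/andP; split; apply/eqP.
  rewrite -mulNr -e1; congr (fine _); apply: eq_integral => s _.
  by case: (f s) => c d /=; rewrite mulNr.
rewrite -e2; congr (fine _); apply: eq_integral => s _.
by case: (f s) => c d /=.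
Qed.

Lemma norm_cint_le f (M : R -> R) (C : R) : cintegrable f ->
  mu.-integrable `[0, +oo[ (EFin \o M) ->
  (forall s, 0 <= s -> `|complex.Re (f s)| <= C * M s) ->
  (forall s, 0 <= s -> `|complex.Im (f s)| <= C * M s) ->
  `|cint f| <= (2%:R * (C * \int[mu]_(s in `[0, +oo[) M s))%:C.
Proof.
move=> [f1 f2] iM b1 b2; apply: le_trans (normc_le_ReIm _) _; rewrite lecR /=.
have iCM : mu.-integrable `[0, +oo[ (EFin \o (fun s => C * M s)).
  exact: (integrableZl (@measurable_half_line R) C iM).
rewrite -RintegralZl// [leRHS](_ : _ = \int[mu]_(s in `[0, +oo[) (C * M s) +
  \int[mu]_(s in `[0, +oo[) (C * M s)); last by ring.
apply: lerD.
  apply: le_trans (le_normr_Rintegral _ f1) _ => //.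
  apply: le_Rintegral => //; first exact: integrable_norm f1.
  by move=> s /=; rewrite in_itv/= andbT; exact: b1.
apply: le_trans (le_normr_Rintegral _ f2) _ => //.
apply: le_Rintegral => //; first exact: integrable_norm f2.
by move=> s /=; rewrite in_itv/= andbT; exact: b2.
Qed.

(** The shift by [pi / 2] turns the sine into a cosine, so this is the complex integrand of which
    [airyK] is the imaginary part. *)
Definition airyE (k : nat) al be ph s : R[i] :=
  airyK k al be (ph + pi / 2) s +i* airyK k al be ph s.

Lemma cintegrable_airyE k al be ph : cintegrable (airyE k al be ph).
Proof. by split; exact: integrable_airyK. Qed.

Lemma airyE_cexp k al be ph s :
  airyE k al be ph s = (s ^+ k)%:C * cexp ((- (s ^+ 3 / 3%:R) - al * s) +i* (ph - be * s)).
Proof.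
rewrite /airyE /airyK /cexp addrAC sinDpihalf.
by apply/eqP; rewrite eq_complex /=; apply/andP; split; apply/eqP; ring.
Qed.

(* [airyE] at [(- be, - ph)] is the complex conjugate of [airyE] at [(be, ph)]. *)
Lemma cint_airyE_conj k al be ph :
  cint (airyE k al be ph) - cint (airyE k al (- be) (- ph)) =
  (2%:R * \int[mu]_(s in `[0, +oo[) airyK k al be ph s)%:C * 'i%C.
Proof.
have e1 s : airyK k al (- be) (- ph + pi / 2) s = airyK k al be (ph + pi / 2) s.
  rewrite /airyK mulNr opprK addrAC sinDpihalf addrAC sinDpihalf.
  by rewrite -cosN opprD !opprK.
have e2 s : airyK k al (- be) (- ph) s = -1 * airyK k al be ph s.
  rewrite /airyK (_ : - ph - - be * s = - (ph - be * s)); last by ring.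
  by rewrite sinN; ring.
rewrite /cint /=; under [X in _ - (X +i* _)]eq_Rintegral do rewrite e1.
under [X in _ - (_ +i* X)]eq_Rintegral do rewrite e2.
rewrite RintegralZl//; last exact: integrable_airyK.
by apply/eqP; rewrite eq_complex /=; apply/andP; split; apply/eqP; ring.
Qed.

(* The integrand of [Airy z] along the ray directed by [w], with [dt = w ds]. *)
Definition airyG z w s : R[i] :=
  cexp ((s%:C * w) ^+ 3 / 3%:R - z * (s%:C * w)) * w.

Lemma AiryE z : Airy z = (2%:R * pi%:C * 'i%C)^-1 *
  (cint (airyG z (cexp (th%:C * 'i%C))) - cint (airyG z (cexp (- th%:C * 'i%C)))).
Proof. by []. Qed.

Lemma airyG_airyE z ph s : cos (3%:R * ph) = -1 -> sin (3%:R * ph) = 0 ->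
  airyG z (cexp (ph%:C * 'i%C)) s =
  airyE 0 (complex.Re z * cos ph - complex.Im z * sin ph)
    (complex.Re z * sin ph + complex.Im z * cos ph) ph s.
Proof.
move=> c3 s3; rewrite /airyG airyE_cexp expr0 mul1r exprMn cexp_iX cexp_iE c3 s3.
rewrite -cexpD; congr cexp.
have -> : (3%:R : R[i])^-1 = (3%:R^-1)%:C by rewrite fmorphV /= rmorph_nat.
rewrite cexp_iE -rmorphXn; case: z => a b.
by apply/eqP; rewrite eq_complex /=; apply/andP; split; apply/eqP; ring.
Qed.

(** The extra factor [t = s e^(i ph)] is the one produced, up to sign, by differentiating the
    integrand in [z]. *)
Lemma airyG_airyE1 z ph s : cos (3%:R * ph) = -1 -> sin (3%:R * ph) = 0 ->
  s%:C * cexp (ph%:C * 'i%C) * airyG z (cexp (ph%:C * 'i%C)) s =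
  airyE 1 (complex.Re z * cos ph - complex.Im z * sin ph)
    (complex.Re z * sin ph + complex.Im z * cos ph) (2%:R * ph) s.
Proof.
move=> c3 s3; rewrite airyG_airyE// !airyE_cexp expr0 expr1 mul1r -mulrA; congr (_ * _).
rewrite -cexpD; congr cexp.
by apply/eqP; rewrite eq_complex /=; apply/andP; split; apply/eqP => /=; ring.
Qed.

Lemma cos3th : cos (3%:R * th) = -1.
Proof. by rewrite mulrC divfK ?cospi// pnatr_eq0. Qed.

Lemma sin3th : sin (3%:R * th) = 0.
Proof. by rewrite mulrC divfK ?sinpi// pnatr_eq0. Qed.

Lemma cos3Nth : cos (3%:R * - th) = -1.
Proof. by rewrite mulrN cosN cos3th. Qed.

Lemma sin3Nth : sin (3%:R * - th) = 0.
Proof. by rewrite mulrN sinN sin3th oppr0. Qed.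

Lemma airyG_real x s :
  airyG x%:C (cexp (th%:C * 'i%C)) s = airyE 0 (cos th * x) (sin th * x) th s /\
  airyG x%:C (cexp ((- th)%:C * 'i%C)) s = airyE 0 (cos th * x) (- (sin th * x)) (- th) s.
Proof.
rewrite !airyG_airyE ?cos3th ?sin3th ?cos3Nth ?sin3Nth//= cosN sinN.
by split; congr (airyE _ _ _ _ _); ring.
Qed.

Lemma airyG1_real x s :
  s%:C * cexp (th%:C * 'i%C) * airyG x%:C (cexp (th%:C * 'i%C)) s =
    airyE 1 (cos th * x) (sin th * x) (2%:R * th) s /\
  s%:C * cexp ((- th)%:C * 'i%C) * airyG x%:C (cexp ((- th)%:C * 'i%C)) s =
    airyE 1 (cos th * x) (- (sin th * x)) (- (2%:R * th)) s.
Proof.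
rewrite !airyG_airyE1 ?cos3th ?sin3th ?cos3Nth ?sin3Nth//= cosN sinN.
by split; congr (airyE _ _ _ _ _); ring.
Qed.

(** The two rays contribute conjugate values, so their difference is [2 i] times an imaginary part
    and the prefactor reduces to [1 / pi]. *)
Lemma airyB_cint k x : (2%:R * pi%:C * 'i%C)^-1 *
  (cint (airyE k (cos th * x) (sin th * x) (k.+1%:R * th)) -
   cint (airyE k (cos th * x) (- (sin th * x)) (- (k.+1%:R * th)))) = (airyB k x)%:C.
Proof.
rewrite cint_airyE_conj /airyB /airyI.
have i0 : ('i%C : R[i]) != 0 by rewrite eq_complex /= oner_eq0 andbF.
have p0 : (pi%:C : R[i]) != 0.
  by rewrite eq_complex /= eqxx andbT gt_eqF ?pi_gt0.
rewrite [in RHS]rmorphM fmorphV /= rmorphM /= rmorph_nat.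
move: (pi%:C) p0 => p p0.
by field; rewrite p0 i0.
Qed.

Lemma Airy_real x : Airy x%:C = (airyB 0 x)%:C.
Proof.
rewrite AiryE -airyB_cint mul1r -rmorphN /=; congr (_ * (cint _ - cint _)).
  by apply/funext => s; rewrite (airyG_real x s).1.
by apply/funext => s; rewrite (airyG_real x s).2.
Qed.

End AiryComplex.

(** * The complex derivative of the Airy function *)

Lemma derive1_taylor (K : numFieldType) (f : K -> K) (x d C : K) : 0 < C ->
  (forall h, `|h| <= 1 -> `|f (x + h) - f x - h * d| <= C * `|h| ^+ 2) ->
  derive1 (f : K^o -> K^o) x = d.
Proof.
move=> C0 hC; rewrite /derive1; apply: (cvg_lim (@norm_hausdorff K K^o)).
apply/cvgrPdist_le => e e0; near=> h.
have h0 : h != 0 by near: h; exact: nbhs_dnbhs_neq.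
have h1 : `|h| <= 1 by near: h; exact: dnbhs0_le.
(* The remainder [C |h|^2], divided by [|h|], is at most [e] in this range. *)
have h2 : `|h| <= e / C by near: h; apply: dnbhs0_le; rewrite divr_gt0.
have nh : 0 < `|h| by rewrite normr_gt0.
rewrite -(ler_pM2l nh) -normrM.
have -> : h * (d - h^-1 *: (f (h + x) - f x : K^o)) = - (f (x + h) - f x - h * d).
  by rewrite -[_ *: _]/(_ * _) mulrBr mulrA divff// mul1r (addrC h); ring.
rewrite normrN (le_trans (hC _ h1))// expr2 mulrCA ler_wpM2l//.
by rewrite mulrC -ler_pdivlMr.
Unshelve. all: by end_near. Qed.

Section AiryDerivative.
Variable R : realType.
Local Open Scope complex_scope.
Local Notation mu := (@lebesgue_measure R).
Local Notation th := (pi / 3%:R : R).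
Implicit Types (x s al be ph : R) (z w h : R[i]).

Lemma airyGD z h w s : airyG (z + h) w s = airyG z w s * cexp (- (h * (s%:C * w))).
Proof. by rewrite /airyG [RHS]mulrAC -cexpD; congr (cexp _ * _); ring. Qed.

Lemma norm_airyK0 al be ph s : 0 <= al -> 0 <= s ->
  `|airyK 0 al be ph s| <= expR (- (s ^+ 3 / 3%:R)).
Proof.
move=> al0 s0; rewrite /airyK expr0 mul1r normrM (le_trans (ler_piMr _ (sin_max _)))//.
by rewrite ger0_norm ?expR_ge0// ler_expR gerDl oppr_le0 mulr_ge0.
Qed.

(** The majorant of the second-order remainder of [e^(- h t)]: [(r s)^2 e^(r s)] with [r <= 2],
    times [e^(- s^3/3)], up to the factor [r^2]. *)
Definition airyQ s := s ^+ 2 * expR (- (s ^+ 3 / 3%:R) - (- 2%:R) * s).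

Lemma integrable_airyQ : mu.-integrable `[0, +oo[ (EFin \o airyQ).
Proof.
have := @integrable_airyK R 2 (- 2%:R) 0 (pi / 2).
have -> // : airyK 2 (- 2%:R) 0 (pi / 2) = airyQ.
by apply/funext => t; rewrite /airyK /airyQ mul0r subr0 sin_pihalf mulr1.
Qed.

(** The increment [h] multiplies the integrand by [e^v] with [v = - h t], so [D] is the integrand at
    [x] times [e^v - 1 - v]. The conditions on [cos ph] and [x] bound the first factor by
    [e^(- s^3/3)]. *)
Lemma airyG_taylor ph x h s : 0 <= cos ph -> cos (3%:R * ph) = -1 ->
  sin (3%:R * ph) = 0 -> 0 <= x -> 0 <= s ->
  let w := cexp (ph%:C * 'i%C) in
  let r := `|complex.Re h| + `|complex.Im h| in r <= 2%:R ->
  let D := airyG (x%:C + h) w s - airyG x%:C w s + h * (s%:C * w * airyG x%:C w s) in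
  `|complex.Re D| <= 4%:R * r ^+ 2 * airyQ s /\
  `|complex.Im D| <= 4%:R * r ^+ 2 * airyQ s.
Proof.
move=> c0 c3 s3 x0 s0 w r r2 D.
have r0 : 0 <= r by exact: addr_ge0.
pose v := - (h * (s%:C * w)).
have DE : D = airyG x%:C w s * (cexp v - 1 - v).
  by rewrite /D airyGD -/v /v; ring.
have hv : `|complex.Re v| <= r * s /\ `|complex.Im v| <= r * s.
  rewrite /v /w cexp_iE /r; case: (h) => a b /=.
  rewrite !mul0r !subr0 !addr0; have := cos_max ph; have := sin_max ph.
  move: (cos ph) (sin ph) => c d d1 c1.
  have e (p q a' b' : R) : `|p| <= 1 -> `|q| <= 1 ->
      `|- (a' * (s * p) + b' * (s * q))| <= (`|a'| + `|b'|) * s.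
    move=> p1 q1; rewrite normrN (le_trans (ler_normD _ _))// mulrDl.
    by apply: lerD; rewrite !normrM (ger0_norm s0) ler_wpM2l// ler_piMr.
  split; last exact: e.
  by have := e c d a (- b) c1 d1; rewrite mulNr (normrN b).
have [g1 g2] : `|complex.Re (airyG x%:C w s)| <= expR (- (s ^+ 3 / 3%:R)) /\
               `|complex.Im (airyG x%:C w s)| <= expR (- (s ^+ 3 / 3%:R)).
  rewrite /w airyG_airyE// /airyE /= mul0r subr0.
  by split; apply: norm_airyK0 => //; exact: mulr_ge0.
have [t1 t2] := cexp_taylor hv.1 hv.2.
set m := expR _ in g1 g2; set T := _ * expR _ in t1 t2.
(* Each component of a complex product is a sum of two products, each bounded by [m * T]; this
   doubles the constant 2 of [cexp_taylor]. *)
have fin : m * T + m * T <= 4%:R * r ^+ 2 * airyQ s.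
  have -> : m * T + m * T = 4%:R * r ^+ 2 * (s ^+ 2 * (m * expR (r * s))) by rewrite /T; ring.
  rewrite ler_wpM2l ?mulr_ge0 ?exprn_ge0// /airyQ ler_wpM2l ?exprn_ge0//.
  by rewrite -expRD ler_expR lerD2l mulNr opprK ler_wpM2r.
rewrite DE; split.
  apply: le_trans (norm_Re_mul _ _) _; apply: le_trans fin.
  by apply: lerD; apply: ler_pM.
apply: le_trans (norm_Im_mul _ _) _; apply: le_trans fin.
by apply: lerD; apply: ler_pM.
Qed.

Lemma cintegrable_airyG z ph : cos (3%:R * ph) = -1 -> sin (3%:R * ph) = 0 ->
  cintegrable (airyG z (cexp (ph%:C * 'i%C))).
Proof.
move=> c3 s3; rewrite (_ : airyG _ _ = airyE 0 (complex.Re z * cos ph - complex.Im z * sin ph)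
    (complex.Re z * sin ph + complex.Im z * cos ph) ph).
  exact: cintegrable_airyE.
by apply/funext => s; rewrite airyG_airyE.
Qed.

Lemma cintegrable_airyG1 z ph : cos (3%:R * ph) = -1 -> sin (3%:R * ph) = 0 ->
  cintegrable (fun s => s%:C * cexp (ph%:C * 'i%C) * airyG z (cexp (ph%:C * 'i%C)) s).
Proof.
move=> c3 s3; rewrite (_ : (fun s => _) = airyE 1 (complex.Re z * cos ph - complex.Im z * sin ph)
    (complex.Re z * sin ph + complex.Im z * cos ph) (2%:R * ph)).
  exact: cintegrable_airyE.
by apply/funext => s; rewrite airyG_airyE1.
Qed.

Lemma cint_airyG_taylor ph x h : 0 <= cos ph -> cos (3%:R * ph) = -1 ->
  sin (3%:R * ph) = 0 -> 0 <= x ->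
  let w := cexp (ph%:C * 'i%C) in
  let r := `|complex.Re h| + `|complex.Im h| in r <= 2%:R ->
  `|cint (airyG (x%:C + h) w) - cint (airyG x%:C w) +
    h * cint (fun s => s%:C * w * airyG x%:C w s)| <=
  (8%:R * r ^+ 2 * \int[mu]_(s in `[0, +oo[) airyQ s)%:C.
Proof.
move=> c0 c3 s3 x0 w r r2.
have i1 := cintegrable_airyG (x%:C + h) c3 s3.
have i2 := cintegrableZ (-1) (cintegrable_airyG x%:C c3 s3).
have i3 := cintegrableZ h (cintegrable_airyG1 x%:C c3 s3).
have i12 := cintegrableD i1 i2.
have i := cintegrableD i12 i3.
have -> : cint (airyG (x%:C + h) w) - cint (airyG x%:C w) +
    h * cint (fun s => s%:C * w * airyG x%:C w s) =
  cint (fun s => airyG (x%:C + h) w s + -1 * airyG x%:C w s + h * (s%:C * w * airyG x%:C w s)).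
  rewrite (cintD i12 i3) (cintD i1 i2) (cintZ _ (cintegrable_airyG x%:C c3 s3)).
  by rewrite (cintZ _ (cintegrable_airyG1 x%:C c3 s3)) mulN1r.
have -> : 8%:R * r ^+ 2 * \int[mu]_(s in `[0, +oo[) airyQ s =
  2%:R * (4%:R * r ^+ 2 * \int[mu]_(s in `[0, +oo[) airyQ s) by ring.
by apply: norm_cint_le => //; [exact: integrable_airyQ| |] => s s0;
  rewrite mulN1r; have [] := airyG_taylor c0 c3 s3 x0 s0 r2.
Qed.

Lemma Airy_taylor x : 0 <= x -> exists2 C : R[i], 0 < C & forall h, `|h| <= 1 ->
  `|Airy (x%:C + h) - Airy x%:C + h * (airyB 1 x)%:C| <= C * `|h| ^+ 2.
Proof.
move=> x0; pose k : R[i] := (2%:R * pi%:C * 'i%C)^-1.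
have q0 : 0 <= \int[mu]_(s in `[0, +oo[) airyQ s.
  apply: Rintegral_ge0 => s /=; rewrite in_itv/= andbT => s0.
  by rewrite mulr_ge0 ?exprn_ge0 ?expR_ge0.
set q := \int[mu]_(s in _) _ in q0.
(* Each of the two rays costs [8 r^2 q], and [r <= 2 |h|], whence [64 = 2 * 8 * 4]; the final 1
   makes the constant strictly positive. *)
exists (`|k| * (64%:R * q)%:C + 1).
  by rewrite ltr_pwDr// mulr_ge0// ler0c mulr_ge0.
move=> h h1.
pose r := `|complex.Re h| + `|complex.Im h|.
have [hre him] := ReIm_le_normc h.
have rh : r%:C <= 2%:R * `|h| by rewrite mulr_natl mulr2n rmorphD lerD.
have r2 : r <= 2%:R.
  by rewrite -lecR (le_trans rh)// rmorph_nat ler_piMr.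
have c0 : 0 <= cos th by exact/ltW/cos_th_gt0.
have c0' : 0 <= cos (- th) by rewrite cosN.
have T1 := cint_airyG_taylor c0 (cos3th R) (sin3th R) x0 r2.
have T2 := cint_airyG_taylor c0' (cos3Nth R) (sin3Nth R) x0 r2.
have e1 : (airyB 1 x)%:C = k *
  (cint (fun s => s%:C * cexp (th%:C * 'i%C) * airyG x%:C (cexp (th%:C * 'i%C)) s) -
   cint (fun s => s%:C * cexp ((- th)%:C * 'i%C) * airyG x%:C (cexp ((- th)%:C * 'i%C)) s)).
  rewrite -airyB_cint; congr (_ * (cint _ - cint _)); apply/funext => s.
    by rewrite (airyG1_real x s).1.
  by rewrite (airyG1_real x s).2.
rewrite !AiryE -/k -!rmorphN e1.
set A1 := cint _; set A2 := cint _; set A3 := cint _; set A4 := cint _.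
set A5 := cint _; set A6 := cint _.
have -> : k * (A1 - A2) - k * (A3 - A4) + h * (k * (A5 - A6)) =
  k * ((A1 - A3 + h * A5) - (A2 - A4 + h * A6)) by ring.
rewrite normrM mulrDl mul1r -[leLHS]addr0 lerD ?exprn_ge0// -mulrA ler_wpM2l//.
apply: le_trans (ler_normB _ _) _; apply: le_trans (lerD T1 T2) _.
rewrite -/q -/r -rmorphD /=.
have -> : 8%:R * r ^+ 2 * q + 8%:R * r ^+ 2 * q = (16%:R * q) * r ^+ 2 by ring.
have -> : (64%:R * q)%:C * `|h| ^+ 2 = (16%:R * q)%:C * (2%:R * `|h|) ^+ 2.
  by rewrite !rmorphM /= !rmorph_nat; ring.
rewrite rmorphM rmorphXn /= ler_wpM2l//; first by rewrite ler0c mulr_ge0.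
by rewrite lerXn2r// nnegrE ?mulr_ge0// ler0c addr_ge0.
Qed.

Lemma Airy'_real x : 0 <= x -> Airy' x%:C = - (airyB 1 x)%:C.
Proof.
move=> x0; have [C C0 hC] := Airy_taylor x0.
apply: (@derive1_taylor (R[i]) (@Airy R) _ _ C C0) => h /hC.
by rewrite mulrN opprK.
Qed.

End AiryDerivative.

(** * Appell sequences and moment functionals *)

Section AppellRecurrence.
Variables (K : numFieldType) (P : nat -> {poly K}).
Hypotheses (P0 : P 0%N = 1) (P1 : P 1%N = 'X) (P2 : P 2%N = 'X^2).
Hypothesis Prec : forall n : nat, (2 <= n)%N ->
  P n.+1 = 'X * P n - (n * (n - 1))%N%:R *: P (n - 2)%N.

(** For [n < 2] the coefficient [n (n - 1)] is zero, so the truncated index [n - 2] is harmless and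
    one formula covers every [n]. *)
Lemma recurrence_mulX n : 'X * P n = P n.+1 + (n * (n - 1))%N%:R *: P (n - 2)%N.
Proof.
case: n => [|[|n]]; first by rewrite P0 P1 mulr1 mul0n scale0r addr0.
  by rewrite P1 P2 subnn muln0 scale0r addr0 expr2.
by rewrite (@Prec n.+2)// subrK.
Qed.

Lemma recurrence_monic n : P n \is monic /\ size (P n) = n.+1.
Proof.
elim/ltn_ind: n => -[|[|[|n]]] ih.
- by rewrite P0 monic1 size_poly1.
- by rewrite P1 monicX size_polyX.
- by rewrite P2 monicXn size_polyXn.
have [mn sn] := ih n.+2 (ltnSn _).
have [_ sm] := ih n (leq_trans (leqnSn _) (leqnSn _)).
have sX : size ('X * P n.+2) = n.+4.
  by rewrite mulrC size_mulX ?monic_neq0// sn.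
have sl : (size (- ((n.+2 * (n.+2 - 1))%N%:R *: P (n.+2 - 2)%N)) < size ('X * P n.+2)%R)%N.
  rewrite size_polyN sX (leq_ltn_trans (size_scale_leq _ _))//.
  by rewrite !subSS !subn0 sm; lia.
rewrite (@Prec n.+2)// size_polyDl// sX; split => //.
by rewrite monicE lead_coefDl// -monicE monicMr// monicX.
Qed.

(** Differentiate the recurrence, insert the derivatives known by induction, and expand
    ['X * P n.+2] by the recurrence again: the terms in [P n] cancel. *)
Lemma recurrence_deriv n : (P n.+1)^`() = n.+1%:R *: P n.
Proof.
elim/ltn_ind: n => -[|[|[|n]]] ih.
- by rewrite P1 P0 derivX scale1r.
- by rewrite P2 P1 derivXn expr1 scaler_nat.
- rewrite (@Prec 2)// derivB derivM derivX linearZ /= P0 derivC scaler0 subr0 P2 derivXn.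
  by rewrite mul1r expr1 mulrnAr -expr2 -mulrS scaler_nat.
have e1 : (P n.+3)^`() = n.+3%:R *: P n.+2 by apply: ih.
have e2 : (P n.+1)^`() = n.+1%:R *: P n by apply: ih; lia.
rewrite (@Prec n.+3)// derivB derivM derivX mul1r derivZ e1.
rewrite (_ : (n.+3 - 2)%N = n.+1); last by lia.
rewrite e2 -scalerAr recurrence_mulX (_ : (n.+2 - 2)%N = n); last by lia.
rewrite scalerDr !scalerA -!natrM.
rewrite (_ : (n.+3 * (n.+3 - 1) * n.+1)%N = (n.+3 * (n.+2 * (n.+2 - 1)))%N); last by lia.
by rewrite addrA addrK -[X in X + _]scale1r -scalerDl nat1r.
Qed.

(** Moving one factor ['X] onto [P n] gives indices [n + 1] and [n - 2], so [m] factors lower the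
    index by at most [2 m]. On the diagonal only the lowest term survives, with coefficient
    [n (n - 1)] nonzero. *)
Lemma recurrence_orthogonal (u : {poly K} -> K) (r : nat) : scalar u ->
  (forall n, (r < n)%N -> u (P n) = 0) -> u (P r) != 0 ->
  forall m n : nat, ((2 * m + r.+1 <= n)%N -> u ('X^m * P n) = 0) /\
    u ('X^m * P (2 * m + r)%N) != 0.
Proof.
move=> lu u0 u1.
have uD p q c : u (p + c *: q) = u p + c * u q by rewrite addrC lu addrC.
have step (m n : nat) : u ('X^(m.+1) * P n) =
    u ('X^m * P n.+1) + (n * (n - 1))%N%:R * u ('X^m * P (n - 2)%N).
  by rewrite exprSr -mulrA recurrence_mulX mulrDr -scalerAr uD.
have orth (m n : nat) : (2 * m + r.+1 <= n)%N -> u ('X^m * P n) = 0.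
  elim: m n => [|m ih] n hn; first by rewrite expr0 mul1r u0.
  rewrite step !ih ?mulr0 ?addr0//; lia.
move=> m n; split; first exact: orth.
elim: m {n} => [|m ih]; first by rewrite muln0 add0n expr0 mul1r.
rewrite step orth; last by lia.
rewrite add0r (_ : (2 * m.+1 + r - 2)%N = (2 * m + r)%N); last by lia.
rewrite mulf_neq0// pnatr_eq0; lia.
Qed.

End AppellRecurrence.

(** * Functionals given by their moments *)

Section MomentFunctional.
Variable K : numFieldType.
Implicit Types (mu : nat -> K) (f : {poly K}).

Definition moment_functional mu f : K := \sum_(i < size f) f`_i * mu i.

Lemma moment_functional_widen mu f n : (size f <= n)%N ->
  moment_functional mu f = \sum_(i < n) f`_i * mu i.
Proof.
move=> hn; rewrite /moment_functional (big_ord_widen n (fun i => f`_i * mu i) hn).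
rewrite big_mkcond; apply: eq_bigr => i _; case: ltnP => // h.
by rewrite nth_default// mul0r.
Qed.

Lemma moment_functional_scalar mu : scalar (moment_functional mu).
Proof.
move=> a p q; pose n := maxn (size (a *: p + q)) (maxn (size p) (size q)).
rewrite !(@moment_functional_widen _ _ n) ?leq_max ?leqnn ?orbT//.
rewrite mulr_sumr -big_split; apply: eq_bigr => i _ /=.
by rewrite coefD coefZ mulrDl mulrA.
Qed.

(** On monomials: the derivative of [x^(i+1)] is [(i+1) x^i], and [nu 0 = 0] matches the vanishing
    derivative of constants. *)
Lemma moment_functional_deriv mu nu f : nu 0 = 0 ->
  (forall i, nu i.+1 = i.+1%:R * mu i) ->
  moment_functional nu f = moment_functional mu f^`().
Proof.
move=> n0 nS.
rewrite (moment_functional_widen _ (leqnSn _)) big_ord_recl n0 mulr0 add0r.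
rewrite (@moment_functional_widen _ f^`() (size f)) ; last first.
  exact: leq_trans (size_poly _ _) (leq_pred _).
by apply: eq_bigr => i _ /=; rewrite nS coef_deriv -mulr_natl; ring.
Qed.

(** On monomials: [x * x^(i+2)] has moment [mu i.+3], which is that of the second derivative of
    [x^(i+2)]; the zero moments at 1 and 2 account for [f = 1] and [f = x]. *)
Lemma moment_functional_mulX mu f : mu 1 = 0 -> mu 2 = 0 ->
  (forall i, mu i.+3 = (i.+2 * i.+1)%:R * mu i) ->
  moment_functional mu ('X * f) = moment_functional mu f^`()^`().
Proof.
move=> mu1 mu2 mu3; have le_deriv (p : {poly K}) : (size p^`() <= size p)%N.
  exact: leq_trans (size_poly _ _) (leq_pred _).
rewrite (@moment_functional_widen _ f^`()^`() (size f)); last exact: leq_trans (le_deriv _) _.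
(* Three extra terms are allowed so that peeling off indices 0, 1 and 2 leaves sums of equal
   length. *)
rewrite (@moment_functional_widen _ ('X * f) (size f).+3); last first.
  by rewrite mulrC (leq_trans (size_polyMleq _ _))// size_polyX; lia.
rewrite !big_ord_recl /= /bump /= !coefXM /= mul0r add0r mu1 mu2 !mulr0 !add0r.
apply: eq_bigr => i _.
rewrite coefXM /= !add1n mu3 !coef_deriv -mulrnA -[in RHS]mulr_natl; ring.
Qed.

End MomentFunctional.

(** * The functionals of the Airy function *)

Section AiryMoments.
Variable R : realType.
Local Open Scope complex_scope.
Local Notation mu := (@lebesgue_measure R).
Local Notation om := (omega R).
Implicit Types (f : {poly R[i]}) (w : R[i]).

Lemma omegaE : om = cexp ((2%:R * pi / 3%:R)%:C * 'i%C).
Proof. by []. Qed.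

Lemma omega3 : om ^+ 3 = 1.
Proof.
rewrite omegaE cexp_iX mulrCA (divff (x := 3%:R)) ?pnatr_eq0// mulr1 cexp_iE.
by rewrite mulr_natl cos2pi sin2pi.
Qed.

Lemma omega_sum : 1 + om + om ^+ 2 = 0.
Proof.
have w1 : om - 1 != 0.
  rewrite subr_eq0 omegaE cexp_iE eq_complex /= negb_and; apply/orP; right.
  by rewrite gt_eqF// sin_gt0_pi//; have := pi_gt0 R; lra.
apply/eqP; rewrite -(mulrI_eq0 _ (mulfI w1)); apply/eqP.
have -> : (om - 1) * (1 + om + om ^+ 2) = om ^+ 3 - 1 by ring.
by rewrite omega3 subrr.
Qed.

Lemma omega_neq0 : om != 0.
Proof. by apply/eqP => h; have := omega3; rewrite h expr0n /= => /esym/eqP; rewrite oner_eq0. Qed.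

Lemma calU_real (k : 'I_2) (x : R) : 0 <= x -> calU k x%:C = (airyB k x)%:C.
Proof.
move=> x0; rewrite /calU; case: k => [[|[|//]] hk] /=; first exact: Airy_real.
by rewrite Airy'_real// opprK.
Qed.

Lemma cint_sum (n : nat) (F : nat -> R -> R[i]) : (forall i, cintegrable (F i)) ->
  cintegrable (fun s => \sum_(i < n) F i s) /\
  cint (fun s => \sum_(i < n) F i s) = \sum_(i < n) cint (F i).
Proof.
move=> iF; elim: n => [|n [ih1 ih2]].
  rewrite (_ : (fun s => _) = cst 0); last by apply/funext => s; rewrite big_ord0.
  split; first by split; exact: integrable0.
  rewrite big_ord0 /cint; apply/eqP; rewrite eq_complex /=.
  by rewrite /Rintegral integral0 eqxx.
rewrite (_ : (fun s => _) = (fun s => (\sum_(i < n) F i s) + F n s)); last first.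
  by apply/funext => s; rewrite big_ord_recr.
by split; [exact: cintegrableD|rewrite cintD// ih2 big_ord_recr].
Qed.

Lemma cint_real (u : R -> R) : mu.-integrable `[0, +oo[ (EFin \o u) ->
  cintegrable (fun s => (u s)%:C) /\
  cint (fun s => (u s)%:C) = (\int[mu]_(s in `[0, +oo[) u s)%:C.
Proof.
move=> iu; split; first by split; [exact: iu|exact: integrable0].
by apply/eqP; rewrite eq_complex /= eqxx /Rintegral integral0 /=.
Qed.

Lemma eq_cint (f g : R -> R[i]) : (forall s, 0 <= s -> f s = g s) ->
  cintegrable g -> cintegrable f /\ cint f = cint g.
Proof.
move=> fg [g1 g2]; split; first split.
- apply: eq_integrable g1 => // s; rewrite inE /= in_itv/= andbT => s0.
  by rewrite fg.
- apply: eq_integrable g2 => // s; rewrite inE /= in_itv/= andbT => s0.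
  by rewrite fg.
rewrite /cint; apply/eqP; rewrite eq_complex /=; apply/andP; split; apply/eqP;
  by apply: eq_Rintegral => s; rewrite inE /= in_itv/= andbT => s0; rewrite fg.
Qed.

(** On the ray [x = s w] the condition [w' * w = 1] makes the argument of [calU] the real number
    [s]; each monomial then yields a real moment times [w ^+ i.+1], one power of [w] coming from
    [dx]. *)
Lemma ray_integral_calU (k : 'I_2) f w w' : w' * w = 1 ->
  let g := fun x => f.[x] * calU k (w' * x) in
  ray_integrable w g /\
  ray_integral w g = \sum_(i < size f) f`_i * w ^+ i.+1 * (airyM R i k)%:C.
Proof.
move=> ww g.
pose F i s : R[i] := f`_i * w ^+ i.+1 * (s ^+ i * airyB k s)%:C.
have iF0 i := cint_real (integrable_airyB R i k).
have iF i : cintegrable (F i) by exact: (cintegrableZ _ (iF0 i).1).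
have [s1 s2] := cint_sum (size f) iF.
have e s : 0 <= s -> g (s%:C * w) * w = \sum_(i < size f) F i s.
  move=> s0; rewrite /g mulrCA ww mulr1 calU_real// horner_coef !mulr_suml.
  apply: eq_bigr => i _; rewrite /F (rmorphM _ (s ^+ i)) /= exprMn exprS -rmorphXn /=; ring.
have [g1 g2] := eq_cint e s1.
split; first exact: g1.
rewrite -[LHS]/(cint (fun s => g (s%:C * w) * w)) g2 s2.
apply: eq_bigr => i _; rewrite /F (cintZ _ (iF0 i).1) (iF0 i).2 //.
Qed.

(** These are the moments of [functional_u]: the contributions of the three rays cancel outside one
    residue class modulo 3. *)
Definition airy_moment (k i : nat) : R[i] :=
  if (i %% 3 == k)%N then (airyM R i k)%:C else 0.

Lemma omega_ray1 (k : 'I_2) f :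
  (fun x => f.[x] * calU k x) = (fun x => f.[x] * calU k (1 * x)).
Proof. by apply/funext => x; rewrite mul1r. Qed.

Lemma functional_u_convergent (k : 'I_2) f : functional_u_converges k f.
Proof.
split.
- by rewrite omega_ray1; apply: (ray_integral_calU k f (mulr1 1)).1.
- by apply: (ray_integral_calU k f _).1; rewrite -exprSr omega3.
- by apply: (ray_integral_calU k f _).1; rewrite -exprS omega3.
Qed.

(* The cube roots of unity filter out the powers [i = k %[mod 3]]. *)
Lemma omega_filter (k : 'I_2) (i : nat) :
  1 + om ^ (2 * k%:Z - 1) * om ^+ i.+1 + om ^ (1 - 2 * k%:Z) * (om ^+ 2) ^+ i.+1 =
  if (i %% 3 == k)%N then 3%:R else 0.
Proof.
have w0 := omega_neq0; have w3 := omega3; have ws := omega_sum.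
have V : om^-1 = om ^+ 2.
  by apply: (mulfI w0); rewrite divff// -exprS w3.
set y := om ^+ i.
have hy : y = om ^+ (i %% 3).
  by rewrite /y {1}(divn_eq i 3) exprD mulnC exprM w3 expr1n mul1r.
rewrite exprAC exprS -/y.
(* The integer exponents are 1 and -1, and [om^-1 = om ^+ 2], so only natural powers, reducible by
   [om ^+ 3 = 1], remain. *)
have [-> ->] : om ^ (2 * k%:Z - 1) = (if k == 0 :> nat then om ^+ 2 else om) /\
    om ^ (1 - 2 * k%:Z) = (if k == 0 :> nat then om else om ^+ 2).
  by case: k => [[|[|//]] hk]; split; rewrite //= ?mulr0 ?sub0r ?subr0 ?mulr1 -?V.
have r3 : (i %% 3 < 3)%N by rewrite ltn_mod.
case: k => [[|[|//]] hk] /=; move: hy r3; case: (i %% 3)%N => [|[|[|//]]] -> _ /=.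
all: rewrite ?expr0 ?expr1.
- have -> : 1 + om ^+ 2 * (om * 1) + om * (om * 1) ^+ 2 = 1 + om ^+ 3 + om ^+ 3 by ring.
  by rewrite w3; ring.
- have -> : 1 + om ^+ 2 * (om * om) + om * (om * om) ^+ 2 = 1 + om * om ^+ 3 + om ^+ 2 * om ^+ 3 by ring.
  by rewrite w3 !mulr1.
- have -> : 1 + om ^+ 2 * (om * om ^+ 2) + om * (om * om ^+ 2) ^+ 2 =
    1 + om ^+ 2 * om ^+ 3 + om * om ^+ 3 * om ^+ 3 by ring.
  by rewrite w3 !mulr1 addrAC.
- have -> : 1 + om * (om * 1) + om ^+ 2 * (om * 1) ^+ 2 = 1 + om ^+ 2 + om * om ^+ 3 by ring.
  by rewrite w3 !mulr1 addrAC.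
- have -> : 1 + om * (om * om) + om ^+ 2 * (om * om) ^+ 2 = 1 + om ^+ 3 + om ^+ 3 * om ^+ 3 by ring.
  by rewrite w3; ring.
- have -> : 1 + om * (om * om ^+ 2) + om ^+ 2 * (om * om ^+ 2) ^+ 2 =
    1 + om * om ^+ 3 + om ^+ 2 * om ^+ 3 * om ^+ 3 by ring.
  by rewrite w3 !mulr1.
Qed.

Lemma functional_uE (k : 'I_2) f :
  functional_u k f = moment_functional (airy_moment k) f.
Proof.
pose S w := \sum_(i < size f) f`_i * w ^+ i.+1 * (airyM R i k)%:C.
have e1 : ray_integral 1 (fun x => f.[x] * calU k x) = S 1.
  by rewrite omega_ray1; apply: (ray_integral_calU k f (mulr1 1)).2.
have e2 : ray_integral om (fun x => f.[x] * calU k (om ^+ 2 * x)) = S om.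
  by apply: (ray_integral_calU k f _).2; rewrite -exprSr omega3.
have e3 : ray_integral (om ^+ 2) (fun x => f.[x] * calU k (om * x)) = S (om ^+ 2).
  by apply: (ray_integral_calU k f _).2; rewrite -exprS omega3.
rewrite /functional_u e1 e2 e3 /S /moment_functional {e1 e2 e3 S}.
rewrite !mulr_sumr -!big_split mulr_sumr; apply: eq_bigr => i _ /=.
have := omega_filter k i; rewrite /airy_moment.
set a := om ^ _; set b := om ^ _ => hf.
transitivity (3%:R^-1 * (1 + a * om ^+ i.+1 + b * (om ^+ 2) ^+ i.+1) *
   (f`_i * (airyM R i k)%:C)); first by rewrite expr1n; ring.
rewrite hf; case: ifP => _; last by rewrite !mulr0 mul0r.
by rewrite mulVf ?mul1r// pnatr_eq0.
Qed.

Lemma airy_moment_deriv i : airy_moment 1 i.+1 = i.+1%:R * airy_moment 0 i.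
Proof.
rewrite /airy_moment airyM_parts rmorphM /= rmorph_nat.
have -> : (i.+1 %% 3 == 1)%N = (i %% 3 == 0)%N by lia.
by case: ifP; rewrite ?mulr0.
Qed.

(** The Airy equation trades one factor [x] for two derivatives, and two integrations by parts
    remove them. *)
Lemma airy_moment0_rec i : airy_moment 0 i.+3 = (i.+2 * i.+1)%:R * airy_moment 0 i.
Proof.
rewrite /airy_moment airyM_S !airyM_parts !rmorphM /= !rmorph_nat natrM.
have -> : (i.+3 %% 3 == 0)%N = (i %% 3 == 0)%N by lia.
by case: ifP; rewrite ?mulr0 ?mulrA.
Qed.

Lemma airy_moment00_neq0 : airy_moment 0 0 != 0.
Proof. by rewrite /airy_moment /= eq_complex /= eqxx andbT gt_eqF// airyM00_gt0. Qed.

End AiryMoments.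

(** * Threefold symmetry, 2-orthogonality and the Appell property *)

Local Open Scope complex_scope.

(** Since [omega ^+ 3 = 1], the indices [n + 3] and [n] give the same factor, so both terms of the
    recurrence transform alike. *)
Lemma threefold_symmetric_recurrence (R : realType) (P : nat -> {poly R[i]}) :
  P 0%N = 1 -> P 1%N = 'X -> P 2%N = 'X^2 ->
  (forall n : nat, (2 <= n)%N ->
    P n.+1 = 'X * P n - (n * (n - 1))%N%:R *: P (n - 2)%N) ->
  threefold_symmetric P.
Proof.
move=> P0 P1 P2 Prec n x; elim/ltn_ind: n => -[|[|[|n]]] ih.
- by rewrite P0 !hornerC mul1r.
- by rewrite P1 !hornerX.
- by rewrite P2 !hornerXn exprMn.
rewrite (@Prec n.+2)// (_ : (n.+2 - 2)%N = n); last by lia.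
rewrite !hornerE (ih n.+2)// (ih n); last by lia.
have -> : omega R ^+ n.+3 = omega R ^+ n by rewrite -addn3 exprD omega3 mulr1.
have w3 : omega R * omega R ^+ n.+2 = omega R ^+ n.
  by rewrite -exprS -addn3 exprD omega3 mulr1.
rewrite mulrBr; congr (_ - _); last by rewrite mulrCA.
by rewrite -w3; ring.
Qed.

Theorem proposition3p9 (R : realType) (P : nat -> {poly R[i]})
  (hP0 : P 0%N = 1) (hP1 : P 1%N = 'X) (hP2 : P 2%N = 'X^2)
  (hP : forall n : nat, (2 <= n)%N ->
    P n.+1 = 'X * P n - (n * (n - 1))%N%:R *: P (n - 2)%N) :
  [/\ threefold_symmetric P,
      forall (k : 'I_2) (f : {poly R[i]}), functional_u_converges k f,
      two_orthogonal (functional_u (0 : 'I_2)) (functional_u (1 : 'I_2)) P &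
      forall n : nat, n.+1%:R^-1 *: deriv (P n.+1) = P n].
Proof.
pose M k := moment_functional (airy_moment R k).
have dP := recurrence_deriv hP0 hP1 hP2 hP.
have u0E : functional_u (0 : 'I_2) = M 0%N.
  by apply/funext => f; rewrite functional_uE.
have u1E : functional_u (1 : 'I_2) = M 1%N.
  by apply/funext => f; rewrite functional_uE.
have lM k : scalar (M k) by exact: moment_functional_scalar.
have MZ k c f : M k (c *: f) = c * M k f.
  by have := lM k c f 0; rewrite addr0 => ->; rewrite /M /moment_functional size_poly0 big_ord0 addr0.
have M1E f : M 1%N f = M 0%N f^`().
  by apply: moment_functional_deriv; [|exact: airy_moment_deriv].
have M0X f : M 0%N ('X * f) = M 0%N f^`()^`().
  by apply: moment_functional_mulX; [| |exact: airy_moment0_rec].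
have M0P0 : M 0%N (P 0%N) != 0.
  rewrite hP0 /M /moment_functional size_poly1 big_ord1 coef1 mul1r.
  exact: airy_moment00_neq0.
(* By the Appell property [n (n - 1) P_(n-2)] is [P_n''], and [u_0] takes the same value on [x P_n]
   and [P_n''], so the two terms of the recurrence cancel. *)
have M0P n : (0 < n)%N -> M 0%N (P n) = 0.
  case: n => // n _.
  have h := recurrence_mulX hP0 hP1 hP2 hP n.
  have -> : P n.+1 = - (n * (n - 1))%N%:R *: P (n - 2)%N + 'X * P n.
    by rewrite h scaleNr addrCA addNr addr0.
  rewrite lM M0X.
  have -> : (P n)^`()^`() = (n * (n - 1))%N%:R *: P (n - 2)%N.
    case: n {h} => [|[|n]].
    - by rewrite hP0 derivC deriv0 mul0n scale0r.
    - by rewrite hP1 derivX derivC muln0 scale0r.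
    by rewrite dP derivZ dP scalerA natrM !subSS !subn0.
  by rewrite MZ mulNr addNr.
(* The derivative of [P_n] is [n P_(n-1)], on which [u_0] vanishes when [n > 1]. *)
have M1P n : (1 < n)%N -> M 1%N (P n) = 0.
  by case: n => // n n0; rewrite M1E dP MZ M0P// mulr0.
have M1P1 : M 1%N (P 1%N) != 0 by rewrite M1E dP MZ mul1r.
split.
- exact: threefold_symmetric_recurrence.
- by move=> k f; exact: functional_u_convergent.
- rewrite u0E u1E; split; [exact: lM|exact: lM|exact: recurrence_monic| |].
  (* The last index on which the functional is nonzero is [r = 0] for [u_0] and [r = 1] for
     [u_1]. *)
  + move=> m n; have := recurrence_orthogonal hP0 hP1 hP2 hP (lM _) M0P M0P0 m n.
    by rewrite addn0.
  + exact: (recurrence_orthogonal hP0 hP1 hP2 hP (lM _) M1P M1P1).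
- by move=> n; rewrite dP scalerA mulVf ?scale1r// pnatr_eq0.
Qed.
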